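(* Let $p\ge1$, $m=2p$, $j=\mathrm{diag}(I_p,-I_p)$. A $p\times p$ matrix function $\varphi$ is the Weyl function of some system determined by parameter matrices $A,S_0,\Pi_0$ with $S_0>0$ (see context) if and only if it admits a representation $$\varphi(\lambda)=-i\widetilde\Phi^*(\theta-\lambda I_n)^{-1}\widetilde\Psi,\qquad \theta-\theta^*=i(\widetilde\Phi\widetilde\Phi^*+\widetilde\Psi\widetilde\Psi^* ),$$ for some $n$, some $n\times n$ matrix $\theta$ and $n\times p$ matrices $\widetilde\Phi,\widetilde\Psi$, such that $\det(\theta-i\widetilde\Psi\widetilde\Psi^* )\neq0$. In that case $\varphi$ is the Weyl function of the system (which has $C_k>0$) determined by the parameter matrices $S_0=I_n$, $A=\theta-i\widetilde\Psi\widetilde\Psi^*$, $\Pi_0=[\widetilde\Phi\ \ \widetilde\Psi]$.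
   Context: Parameter matrices: an $n\times n$ matrix $A$ with $\det A\neq0$, an $n\times n$ matrix $S_0=S_0^*$ and an $n\times m$ matrix $\Pi_0$ with $AS_0-S_0A^*=i\Pi_0j\Pi_0^*$. They determine $\Pi_{k+1}=\Pi_k+iA^{-1}\Pi_kj$, $S_{k+1}=S_k+A^{-1}S_k(A^* )^{-1}+A^{-1}\Pi_k\Pi_k^*(A^* )^{-1}$ and $C_k=I_m+\Pi_k^*S_k^{-1}\Pi_k-\Pi_{k+1}^*S_{k+1}^{-1}\Pi_{k+1}$ ($k\ge0$), and the system determined by them is $W_{k+1}(\lambda)-W_k(\lambda)=-\frac{i}{\lambda}jC_kW_k(\lambda)$, $k\ge0$, with $W_0=I_m$. With $\mathbb C_-$ the open lower half-plane and $q(\lambda)=|\lambda|^2(|\lambda|^2+1)^{-1}$, a $p\times p$ matrix function $\varphi$ holomorphic in $\mathbb C_-$ is a Weyl function of the system if for every $\lambda\in\mathbb C_-$ the series $\sum_{k=0}^\infty [\varphi(\lambda)^*\ \ I_p]q(\lambda)^kW_k(\lambda)^*C_kW_k(\lambda)\begin{bmatrix}\varphi(\lambda)\\ I_p\end{bmatrix}$ converges. *)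

(* Defs.v *)
(* complex numbers C = R[i] over an abstract realType R
   (mathcomp-real-closed's complex), matrices from mathcomp, conjugate
   transpose M ^t* from mathcomp's spectral.v. *)
From HB Require Import structures.
From mathcomp Require Import all_boot all_order all_algebra.
From mathcomp Require Import sesquilinear spectral complex reals.
Set Implicit Arguments.
Unset Strict Implicit.
Unset Printing Implicit Defensive.
Import Order.TTheory GRing.Theory Num.Theory.
Local Open Scope ring_scope.
Local Open Scope sesquilinear_scope.

Section WeylDefs.
Variable R : realType.
Local Notation C := R[i].

(* the imaginary unit *)
Definition Ii : C := Complex 0 1.


(* open lower half-plane *)
Definition lower_half (z : C) : Prop := complex.Im z < 0.

(* j = diag(I_p, -I_p), an m x m matrix with m = p + p = 2p *)
Definition jmat (p : nat) : 'M[C]_(p + p) :=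
  block_mx 1%:M 0 0 (- 1%:M).

(* positive definite (Hermitian) matrix: M = M^* and x^* M x > 0 for x <> 0 *)
Definition posdef (n : nat) (M : 'M[C]_n) : Prop :=
  M ^t* = M /\ forall x : 'cV[C]_n, x != 0 -> 0 < (x ^t* *m M *m x) 0 0.

Variables (n p : nat).

(* parameter matrices: det A <> 0, S0 = S0^*, A S0 - S0 A^* = i Pi0 j Pi0^* *)
Definition param_matrices (A S0 : 'M[C]_n) (Pi0 : 'M[C]_(n, p + p)) : Prop :=
  \det A != 0 /\ S0 ^t* = S0 /\
  A *m S0 - S0 *m A ^t* = Ii *: (Pi0 *m jmat p *m Pi0 ^t*).

Variables (A S0 : 'M[C]_n) (Pi0 : 'M[C]_(n, p + p)).

(* Pi_{k+1} = Pi_k + i A^{-1} Pi_k j *)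
Fixpoint Pik (k : nat) : 'M[C]_(n, p + p) :=
  if k is k'.+1 then Pik k' + Ii *: (invmx A *m Pik k' *m jmat p) else Pi0.

(* S_{k+1} = S_k + A^{-1} S_k (A^* )^{-1} + A^{-1} Pi_k Pi_k^* (A^* )^{-1} *)
Fixpoint Sk (k : nat) : 'M[C]_n :=
  if k is k'.+1 then
    Sk k' + invmx A *m Sk k' *m invmx (A ^t*)
          + invmx A *m Pik k' *m (Pik k') ^t* *m invmx (A ^t*)
  else S0.

(* C_k = I_m + Pi_k^* S_k^{-1} Pi_k - Pi_{k+1}^* S_{k+1}^{-1} Pi_{k+1} *)
Definition Ck (k : nat) : 'M[C]_(p + p) :=
  1%:M + (Pik k) ^t* *m invmx (Sk k) *m Pik k
       - (Pik k.+1) ^t* *m invmx (Sk k.+1) *m Pik k.+1.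

(* W_0 = I_m,  W_{k+1}(l) = W_k(l) - (i/l) j C_k W_k(l) *)
Fixpoint Wk (k : nat) (l : C) : 'M[C]_(p + p) :=
  if k is k'.+1 then Wk k' l - (Ii / l) *: (jmat p *m Ck k' *m Wk k' l)
  else 1%:M.

End WeylDefs.
Arguments Ii {R}.

(* convergence of a series of complex matrices (entrywise, w.r.t. the
   modulus on C) *)
Definition mx_series_converges (R : realType) (a b : nat)
  (u : nat -> 'M[R[i]]_(a, b)) : Prop :=
  exists L : 'M[R[i]]_(a, b), forall e : R[i], 0 < e ->
    exists N : nat, forall N', (N <= N')%N -> forall i j,
      `| (\sum_(k < N') u k) i j - L i j | < e.

(* holomorphy of a matrix function in the open lower half-plane:
   complex differentiability (entrywise) at every point of C_- *)
Definition holomorphic_lower (R : realType) (a b : nat)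
  (f : R[i] -> 'M[R[i]]_(a, b)) : Prop :=
  forall z : R[i], lower_half z ->
    exists D : 'M[R[i]]_(a, b), forall e : R[i], 0 < e ->
      exists d : R[i], 0 < d /\ forall h : R[i], h != 0 -> `|h| < d ->
        forall i j, `| (f (z + h) i j - f z i j) / h - D i j | < e.

(* q(l) = |l|^2 (|l|^2 + 1)^{-1} *)
Definition qfun (R : realType) (l : R[i]) : R[i] :=
  `|l| ^+ 2 / (`|l| ^+ 2 + 1).

(* phi is a Weyl function of the system determined by A, S0, Pi0 *)
Definition is_Weyl_function (R : realType) (n p : nat)
  (A S0 : 'M[R[i]]_n) (Pi0 : 'M[R[i]]_(n, p + p))
  (phi : R[i] -> 'M[R[i]]_p) : Prop :=
  holomorphic_lower phi /\
  forall l : R[i], lower_half l ->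
    mx_series_converges (fun k =>
      (col_mx (phi l) 1%:M) ^t* *m (qfun l ^+ k *:
        ((Wk A S0 Pi0 k l) ^t* *m Ck A S0 Pi0 k *m Wk A S0 Pi0 k l))
      *m col_mx (phi l) 1%:M).

(* Main.v *)
Require Import Defs.
From HB Require Import structures.
From mathcomp Require Import all_boot all_order all_algebra.
From mathcomp Require Import sesquilinear spectral complex reals ring.
From mathcomp Require Import boolp classical_sets.
Set Implicit Arguments.
Unset Strict Implicit.
Unset Printing Implicit Defensive.
Import Order.TTheory GRing.Theory Num.Theory.
Local Open Scope ring_scope.
Local Open Scope sesquilinear_scope.

(** Let X_k = E - i j Pi_k^* S_k^{-1} Z_k, where j E = E J, J^2 = 1, A Z_0 = l Z_0 + Pi_0 E
and Z_{k+1} = Z_k + i A^{-1} Z_k J.  Then (l - i j C_k) X_k = X_{k+1} (l - i J).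
With E = [0; V] and J = -1 this gives the solution
W_k [phi; I] = (1 + i/l)^k X_k, and X_k^* j X_k = - V^* V + 2 Im(l) Z_k^* S_k^{-1} Z_k <= 0.
With l = 0, E = I and J = j it gives C_k j C_k = j, so q^k W_k^* j W_k increases by a positive
multiple of q^k W_k^* C_k W_k at each step, and the Weyl series is bounded.
Moreover C_k > 0 by a Schur complement computation, hence C_k >= j, so every term of the series
on [g; 0] is at least g^* g: there is at most one phi for each system.  Finally S_0 = L L^*, and the
similarity by L reduces to S_0 = I without changing the C_k. *)

(** * Conjugate transposes and the intertwining relation *)

(** The Weyl solution cannot be built from the resolvent of [A]. For [A = theta - i Psi Psi^*] the
    difference [A - A^*] equals [i Phi Phi^* - i Psi Psi^*], whose two parts have opposite signs,
    and [A - l] may be singular in the lower half-plane. The matrix [theta] has nonnegative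
    imaginary part, so [theta - l] is invertible there. Put [Z_0 = (theta - l)^{-1} Psi]; moving
    [i Psi Psi^* Z_0] to the right-hand side gives [A Z_0 = l Z_0 + Psi V] with
    [V = I - i Psi^* Z_0]. For the same [V] the lower block of [X_0] is [I] and the upper one is the
    claimed [phi]. For necessity, no representation is extracted from the given [phi]. The
    normalized system supplies [Phi], [Psi] as the two blocks of its [Pi_0], and
    [theta = A + i Psi Psi^*]. The function built from them has a convergent series, and uniqueness,
    applied separately at each [l], forces [phi] to equal it. *)

Section ConjugateTranspose.
Variable C : numClosedFieldType.

Lemma adjmxD m n (A B : 'M[C]_(m, n)) : (A + B) ^t* = A ^t* + B ^t*.
Proof. by rewrite linearD map_mxD. Qed.

Lemma adjmxN m n (A : 'M[C]_(m, n)) : (- A) ^t* = - A ^t*.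
Proof. by rewrite linearN map_mxN. Qed.

Lemma adjmxB m n (A B : 'M[C]_(m, n)) : (A - B) ^t* = A ^t* - B ^t*.
Proof. by rewrite adjmxD adjmxN. Qed.

Lemma adjmxZ m n a (A : 'M[C]_(m, n)) : (a *: A) ^t* = a^* *: A ^t*.
Proof. by rewrite linearZ map_mxZ. Qed.

Lemma adjmxM m n p (A : 'M[C]_(m, n)) (B : 'M[C]_(n, p)) :
  (A *m B) ^t* = B ^t* *m A ^t*.
Proof. by rewrite trmx_mul map_mxM. Qed.

Lemma adjmx1 n : (1%:M : 'M[C]_n) ^t* = 1%:M.
Proof. by rewrite trmx1 map_mx1. Qed.

Lemma adjmx0 m n : (0 : 'M[C]_(m, n)) ^t* = 0.
Proof. by rewrite trmx0 map_mx0. Qed.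

Lemma adjmxE m n (A : 'M[C]_(m, n)) i j : A ^t* i j = (A j i)^*.
Proof. by rewrite !mxE. Qed.

Lemma adjmx_inv n (A : 'M[C]_n) : (invmx A) ^t* = invmx (A ^t*).
Proof. by rewrite trmx_inv map_invmx. Qed.

Lemma adjmx_unit n (A : 'M[C]_n) : (A ^t* \in unitmx) = (A \in unitmx).
Proof. by rewrite map_unitmx unitmx_tr. Qed.

Lemma adjmx_block m1 m2 n1 n2 (A : 'M[C]_(m1, n1)) (B : 'M[C]_(m1, n2))
    (D : 'M[C]_(m2, n1)) (F : 'M[C]_(m2, n2)) :
  (block_mx A B D F) ^t* = block_mx (A ^t*) (D ^t*) (B ^t*) (F ^t*).
Proof. by rewrite tr_block_mx map_block_mx. Qed.

Lemma adjmx_row m n1 n2 (A : 'M[C]_(m, n1)) (B : 'M[C]_(m, n2)) :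
  (row_mx A B) ^t* = col_mx (A ^t*) (B ^t*).
Proof. by rewrite tr_row_mx map_col_mx. Qed.

Lemma adjmx_col m1 m2 n (A : 'M[C]_(m1, n)) (B : 'M[C]_(m2, n)) :
  (col_mx A B) ^t* = row_mx (A ^t*) (B ^t*).
Proof. by rewrite tr_col_mx map_row_mx. Qed.

End ConjugateTranspose.

Lemma addmxE (R : nmodType) m n (A B : 'M[R]_(m, n)) i j :
  (A + B) i j = A i j + B i j.
Proof. by rewrite mxE. Qed.

Lemma oppmxE (R : zmodType) m n (A : 'M[R]_(m, n)) i j : (- A) i j = - A i j.
Proof. by rewrite mxE. Qed.

Lemma scalemxE (R : nzRingType) m n a (A : 'M[R]_(m, n)) i j :
  (a *: A) i j = a * A i j.
Proof. by rewrite mxE. Qed.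

Lemma IiIi (R : realType) : (Ii : R[i]) * Ii = -1.
Proof. by rewrite /Ii; apply/eqP; rewrite eq_complex /=; apply/andP; split; apply/eqP; ring. Qed.

Lemma conj_Ii (R : realType) : (Ii : R[i])^* = - Ii.
Proof. by apply/eqP; rewrite eq_complex /= oppr0 !eqxx. Qed.

Ltac mxdistr :=
  rewrite ?(mulmxDl, mulmxDr, mulmxN, mulNmx, scalerDr, scalerN, scalerA,
    =^~ scalemxAl, =^~ scalemxAr, mulmxA, mulmx1, mul1mx).

(* Fully expanded matrix products are atoms for the final call to ring. *)
Ltac mxlin II :=
  mxdistr;
  let x := fresh in let y := fresh in
  apply/matrixP => x y; rewrite ?(addmxE, oppmxE, scalemxE);
  repeat match goal with |- context [@fun_of_matrix ?T ?p ?q ?M x y] =>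
    move: (@fun_of_matrix T p q M x y) => ? end;
  ring: II.

Section Intertwining.
Variables (C : numClosedFieldType) (I : C) (n m r : nat).
Variables (A S S' : 'M[C]_n) (P P' : 'M[C]_(n, m)) (j D : 'M[C]_m).
Hypotheses (II : I * I = -1) (conjI : I^* = - I).
Hypotheses (Aunit : A \in unitmx) (Sunit : S \in unitmx) (S'unit : S' \in unitmx).
Hypotheses (jj : j *m j = 1%:M) (jH : j ^t* = j).
Hypothesis ident : A *m S - S *m A ^t* = I *: (P *m j *m P ^t*).
Hypothesis defP' : P' = P + I *: (invmx A *m P *m j).
Hypothesis defS' : S' = S + invmx A *m S *m invmx (A ^t*)
  + invmx A *m P *m P ^t* *m invmx (A ^t*).
Hypothesis defD : D = 1%:M + P ^t* *m invmx S *m P - P' ^t* *m invmx S' *m P'.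

Lemma intertwining (l : C) (E : 'M[C]_(m, r)) (J : 'M[C]_r)
    (Z Z' : 'M[C]_(n, r)) (X X' : 'M[C]_(m, r)) :
  j *m E = E *m J -> J *m J = 1%:M -> A *m Z = l *: Z + P *m E ->
  Z' = Z + I *: (invmx A *m Z *m J) ->
  X = E - I *: (j *m P ^t* *m invmx S *m Z) ->
  X' = E - I *: (j *m P' ^t* *m invmx S' *m Z') ->
  A *m Z' = l *: Z' + P' *m E /\
  l *: X - I *: (j *m D *m X) = l *: X' - I *: (X' *m J).
Proof.
move=> jE JJ AZ defZ' defX defX'.
have A'unit : A ^t* \in unitmx by rewrite adjmx_unit.
(* [Y] and [Y'] are made opaque, so that [S Y = Z] and [S' Y' = Z'] stand for the inverses and
   [mxlin] can treat the products as atoms. *)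
set Y := invmx S *m Z in defX *; set Y' := invmx S' *m Z' in defX' *.
have defZ : Z = S *m Y by rewrite mulKVmx.
have SY' : S' *m Y' = Z' by rewrite mulKVmx.
have YE : invmx S *m Z = Y by [].
have YE' : invmx S' *m Z' = Y' by [].
have defX2 : X = E - I *: (j *m P ^t* *m Y) by rewrite defX !mulmxA.
have defX2' : X' = E - I *: (j *m P' ^t* *m Y') by rewrite defX' !mulmxA.
clearbody Y Y'.
have P'H : P' ^t* = P ^t* - I *: (j *m P ^t* *m invmx (A ^t*)).
  by rewrite defP' adjmxD adjmxZ !adjmxM jH adjmx_inv conjI scaleNr mulmxA.
have P'A : P' ^t* *m A ^t* = P ^t* *m A ^t* - I *: (j *m P ^t*).
  by rewrite P'H mulmxBl -scalemxAl mulmxKV.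
have S'A : S' *m A ^t* = S *m A ^t* + invmx A *m S + invmx A *m P *m P ^t*.
  by rewrite defS' !mulmxDl !mulmxKV.
have P'E : P' *m E = P *m E + I *: (invmx A *m P *m E *m J).
  by rewrite defP' mulmxDl -scalemxAl -!mulmxA jE.
have aZ : l *: (invmx A *m Z) + invmx A *m P *m E = Z.
  by rewrite scalemxAr -mulmxA -mulmxDr -AZ mulKmx.
have ZJ : Z *m J = l *: (invmx A *m Z *m J) + invmx A *m P *m E *m J.
  by rewrite -{1}aZ mulmxDl -scalemxAl.
have AZ' : A *m Z' = l *: Z' + P' *m E.
  rewrite P'E defZ' mulmxDr -scalemxAr -!mulmxA mulKVmx // AZ {1}ZJ.
  by mxlin II.
split=> //.
(* The identity for [A S - S A^*] replaces [i P j P^* Y], and the state equation then cancels [P E].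
   What remains is [S] times a matrix, so [S^{-1}] disappears from [P^* S^{-1} P X]; the same
   happens with [P' X] and [S']. *)
have PX : P *m X = S *m A ^t* *m Y - l *: Z.
  have /(congr1 (mulmx^~ Y)) := ident.
  rewrite mulmxBl -(mulmxA A) -defZ AZ -scalemxAl -!mulmxA => H.
  rewrite defX2 mulmxBr -scalemxAr !mulmxA -!mulmxA -H.
  by mxlin II.
have jX : j *m X = E *m J - I *: (P ^t* *m Y).
  by rewrite defX2 mulmxBr -scalemxAr !mulmxA jj mul1mx jE.
have P'X : P' *m X = S' *m A ^t* *m Y - l *: Z' + I *: (Z' *m J).
  have PPY : invmx A *m P *m P ^t* *m Y
      = S' *m A ^t* *m Y - S *m A ^t* *m Y - invmx A *m Z.
    by rewrite S'A defZ; mxlin II.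
  rewrite defP' mulmxDl PX -scalemxAl -(mulmxA _ _ X) jX mulmxBr -scalemxAr.
  rewrite !mulmxA PPY defZ' mulmxDl -!scalemxAl -(mulmxA _ J J) JJ ZJ.
  by mxlin II.
have PSPX : P ^t* *m invmx S *m P *m X = P ^t* *m A ^t* *m Y - l *: (P ^t* *m Y).
  by rewrite -mulmxA PX mulmxBr -scalemxAr -!mulmxA mulKmx // YE.
have P'SP'X : P' ^t* *m invmx S' *m P' *m X
    = P' ^t* *m A ^t* *m Y - l *: (P' ^t* *m Y') + I *: (P' ^t* *m Y' *m J).
  rewrite -mulmxA P'X mulmxDr mulmxBr -!scalemxAr -!mulmxA mulKmx // YE'.
  by rewrite (mulmxA (invmx S')) YE'.
have DX : D *m X = X + I *: (j *m P ^t* *m Y) - l *: (P ^t* *m Y)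
   + l *: (P' ^t* *m Y') - I *: (P' ^t* *m Y' *m J).
  by rewrite defD mulmxBl mulmxDl mul1mx PSPX P'SP'X P'A; mxlin II.
rewrite -mulmxA DX !mulmxDr !mulmxN -!scalemxAr !mulmxA jX jj mul1mx defX2 defX2'.
by mxlin II.
Qed.
End Intertwining.

(** * Positive definite matrices and one step of the recursion *)

Lemma invmx_left (F : fieldType) n (A B : 'M[F]_n) : A *m B = 1%:M -> invmx A = B.
Proof.
move=> AB; have [Au _] := mulmx1_unit AB.
by rewrite -[LHS]mulmx1 -AB mulKmx.
Qed.

Section PositiveMatrices.
Variable C : numClosedFieldType.

Definition qform n (M : 'M[C]_n) (x : 'cV[C]_n) : C := (x ^t* *m M *m x) 0 0.

Definition pdmx n (M : 'M[C]_n) : Prop :=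
  M ^t* = M /\ forall x : 'cV[C]_n, x != 0 -> 0 < qform M x.

Definition psdmx n (M : 'M[C]_n) : Prop :=
  M ^t* = M /\ forall x : 'cV[C]_n, 0 <= qform M x.

Lemma qformD n (M N : 'M[C]_n) x : qform (M + N) x = qform M x + qform N x.
Proof. by rewrite /qform mulmxDr mulmxDl addmxE. Qed.

Lemma qformN n (M : 'M[C]_n) x : qform (- M) x = - qform M x.
Proof. by rewrite /qform mulmxN mulNmx oppmxE. Qed.

Lemma qformZ n a (M : 'M[C]_n) x : qform (a *: M) x = a * qform M x.
Proof. by rewrite /qform -scalemxAr -scalemxAl scalemxE. Qed.

Lemma qform_congr n m (U : 'M[C]_(m, n)) (M : 'M[C]_m) x :
  qform (U ^t* *m M *m U) x = qform M (U *m x).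
Proof. by rewrite /qform adjmxM !mulmxA. Qed.

Lemma qform_scale_le0 n (M : 'M[C]_n) a x : qform M x <= 0 -> qform M (a *: x) <= 0.
Proof.
move=> Mx; rewrite /qform adjmxZ -!scalemxAl -scalemxAr !scalemxE mulrA -normCKC.
by rewrite mulr_ge0_le0 ?exprn_ge0.
Qed.

Lemma qform0 n (M : 'M[C]_n) : qform M 0 = 0.
Proof. by rewrite /qform mulmx0 mxE. Qed.

Lemma qform1E n (x : 'cV[C]_n) : qform 1%:M x = \sum_i `|x i 0| ^+ 2.
Proof.
rewrite /qform mulmx1 mxE; apply: eq_bigr => i _.
by rewrite adjmxE mulrC -normCK.
Qed.

Lemma qform1_ge0 n (x : 'cV[C]_n) : 0 <= qform 1%:M x.
Proof. by rewrite qform1E sumr_ge0 // => i _; rewrite exprn_ge0. Qed.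

Lemma qform1_eq0 n (x : 'cV[C]_n) : (qform 1%:M x == 0) = (x == 0).
Proof.
apply/eqP/eqP => [|->]; last by rewrite qform0.
rewrite qform1E => /eqP; rewrite psumr_eq0 => [/allP x0|i _]; last by rewrite exprn_ge0.
apply/colP => i; rewrite mxE; apply/eqP.
by have := x0 i (mem_index_enum _); rewrite expf_eq0 normr_eq0.
Qed.

Lemma pdmx1 n : pdmx (1%:M : 'M[C]_n).
Proof. by split=> [|x x0]; rewrite ?adjmx1 // lt_def qform1_eq0 x0 qform1_ge0. Qed.

Lemma pdmx_psd n (M : 'M[C]_n) : pdmx M -> psdmx M.
Proof.
case=> MH Mp; split=> // x; have [->|/Mp/ltW//] := eqVneq x 0.
by rewrite qform0.
Qed.

Lemma psdmx_congr n m (M : 'M[C]_n) (U : 'M[C]_(n, m)) :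
  psdmx M -> psdmx (U ^t* *m M *m U).
Proof.
by case=> MH Mp; split=> [|x]; rewrite ?qform_congr // !adjmxM MH trmxCK !mulmxA.
Qed.

Lemma pdmx_congr n (M U : 'M[C]_n) :
  U \in unitmx -> pdmx M -> pdmx (U *m M *m U ^t*).
Proof.
move=> Uu [MH Mp]; split=> [|x x0]; first by rewrite !adjmxM MH trmxCK !mulmxA.
rewrite -{1}[U]trmxCK qform_congr; apply: Mp.
apply: contra_neq x0 => Ux0; rewrite -[x](@mulKmx _ _ _ (U ^t*)) ?adjmx_unit //.
by rewrite Ux0 mulmx0.
Qed.

Lemma psdmx_gram n m (P : 'M[C]_(n, m)) : psdmx (P *m P ^t*).
Proof.
have := psdmx_congr (P ^t*) (pdmx_psd (pdmx1 m)).
by rewrite trmxCK mulmx1.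
Qed.

Lemma pdmxD n (M N : 'M[C]_n) : pdmx M -> psdmx N -> pdmx (M + N).
Proof.
move=> [MH Mp] [NH Np]; split=> [|x x0]; first by rewrite adjmxD MH NH.
by rewrite qformD ltr_wpDr // Mp.
Qed.

Lemma psdmxD n (M N : 'M[C]_n) : psdmx M -> psdmx N -> psdmx (M + N).
Proof.
move=> [MH Mp] [NH Np]; split=> [|x]; first by rewrite adjmxD MH NH.
by rewrite qformD addr_ge0.
Qed.

Lemma pdmx_unit n (M : 'M[C]_n) : pdmx M -> M \in unitmx.
Proof.
case=> _ Mp; rewrite unitmxE unitfE; apply/negP => /det0P[v v0 vM].
have : 0 < qform M (v ^t*).
  by apply: Mp; apply: contra_neq v0 => v0; rewrite -[v]trmxCK v0 adjmx0.
by rewrite /qform trmxCK vM mul0mx mxE ltxx.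
Qed.

Lemma pdmx_inv n (M : 'M[C]_n) : pdmx M -> pdmx (invmx M).
Proof.
move=> Mp; have Mu := pdmx_unit Mp; have [MH _] := Mp.
have -> : invmx M = invmx M *m M *m (invmx M) ^t*.
  by rewrite mulVmx // mul1mx adjmx_inv MH.
by apply: pdmx_congr; rewrite ?unitmx_inv.
Qed.

(** Both differences are Schur complements of the block matrix with diagonal [D], [S] and
    off-diagonal [P]: its form at [(v, u)] is computed by completing the square in either
    variable. *)
Lemma pdmx_schur n m (D : 'M[C]_m) (S : 'M[C]_n) (P : 'M[C]_(n, m)) :
  pdmx D -> pdmx S -> pdmx (S - P *m invmx D *m P ^t*) ->
  pdmx (D - P ^t* *m invmx S *m P).
Proof.
move=> Dp Sp SDp; have Su := pdmx_unit Sp; have Du := pdmx_unit Dp.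
have [[DH Dpos] [SH _] [_ SDpos]] := (And3 Dp Sp SDp).
split=> [|v v0].
  by rewrite adjmxB !adjmxM adjmx_inv SH DH trmxCK !mulmxA.
(* This [u] makes the square of the completion over [u] vanish; [w] below is the argument of the
   square in the completion over [v]. *)
pose u := - (invmx S *m P *m v).
have Su' : S *m u = - (P *m v) by rewrite mulmxN -!mulmxA mulKVmx.
have uS : u ^t* *m S = - (v ^t* *m P ^t*).
  by rewrite -[LHS]trmxCK adjmxM SH trmxCK Su' adjmxN adjmxM.
pose w := v + invmx D *m P ^t* *m u.
have -> : qform (D - P ^t* *m invmx S *m P) v
    = qform (S - P *m invmx D *m P ^t*) u + qform D w.
  have Dw : D *m w = D *m v + P ^t* *m u by rewrite mulmxDr -!mulmxA mulKVmx.
  have wE : w ^t* = v ^t* + u ^t* *m P *m invmx D.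
    by rewrite adjmxD !adjmxM adjmx_inv DH trmxCK !mulmxA.
  rewrite /qform -!mulmxA Dw wE -addmxE; congr (fun_of_matrix _ 0 0).
  rewrite !mulmxBl !mulmxBr !mulmxDl !mulmxDr.
  rewrite [u ^t* *m (S *m u)]mulmxA uS -!mulmxA mulKmx //.
  have uPv : u ^t* *m (P *m v) = v ^t* *m P ^t* *m u.
    by rewrite -[P *m v]opprK -Su' mulmxN mulmxA uS mulNmx opprK.
  have -> : invmx S *m (P *m v) = - u by rewrite mulmxA opprK.
  by rewrite uPv !mulmxN !mulmxA mulNmx; clearbody u; mxlin (mulr1 (1 : C)).
(* Only [v] is known to be nonzero. If [u = 0], then [w = v] and strictness comes from [D]. *)
have [u0|u0] := eqVneq u 0; last first.
  by apply: lt_le_trans (SDpos u u0) _; rewrite lerDl (pdmx_psd Dp).2.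
by rewrite /w u0 mulmx0 addr0 qform0 add0r Dpos.
Qed.
End PositiveMatrices.

(** From [M j M = j] comes [M^{-1} = j M j], whence [(M - j) M^{-1} (M - j) = M - 2 j + j M^{-1} j =
    2 (M - j)]: up to a factor 2, [M - j] is a congruence of a positive matrix. *)
Lemma pdmx_dom_sign (C : numClosedFieldType) n (M j : 'M[C]_n) :
  pdmx M -> j *m j = 1%:M -> j ^t* = j -> M *m j *m M = j -> psdmx (M - j).
Proof.
move=> Mp jj jH MjM; have [MH _] := Mp.
have MI : invmx M = j *m M *m j.
  by apply: invmx_left; rewrite !mulmxA MjM jj.
have -> : M - j = (2%:R^-1) *: ((M - j) ^t* *m invmx M *m (M - j)).
  rewrite adjmxB MH jH mulmxBl mulmxV ?pdmx_unit // mulmxBl mul1mx MI.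
  have -> : j *m (j *m M *m j) = M *m j by rewrite !mulmxA jj mul1mx.
  rewrite mulmxBr MjM -(mulmxA M j j) jj mulmx1.
  have -> : M - j - (j - M) = 2%:R *: (M - j) by rewrite opprB scaler_nat mulr2n.
  by rewrite scalerA mulVf ?scale1r ?pnatr_eq0.
have [H P] := psdmx_congr (M - j) (pdmx_psd (pdmx_inv Mp)).
split=> [|x]; first by rewrite adjmxZ H conj_Creal // rpredV rpred_nat.
by rewrite qformZ mulr_ge0 // invr_ge0 ler0n.
Qed.

Section FormIdentity.
Variables (C : numClosedFieldType) (I : C) (n m r : nat).
Variables (A S : 'M[C]_n) (P : 'M[C]_(n, m)) (j : 'M[C]_m).
Hypotheses (II : I * I = -1) (conjI : I^* = - I) (Spos : pdmx S).
Hypotheses (jj : j *m j = 1%:M) (jH : j ^t* = j).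
Hypothesis ident : A *m S - S *m A ^t* = I *: (P *m j *m P ^t*).

(** The expansion contains [Z^* S^{-1} P j P^* S^{-1} Z]. The identity and the state equation
    rewrite it so that the cross terms with [E] cancel and only the factor [l^* - l] survives. At
    [l = 0] this is [j]-unitarity, in the half-plane it fixes a sign. *)
Lemma form_identity l (E : 'M[C]_(m, r)) (Z : 'M[C]_(n, r)) X :
  A *m Z = l *: Z + P *m E -> X = E - I *: (j *m P ^t* *m invmx S *m Z) ->
  X ^t* *m j *m X
    = E ^t* *m j *m E + (I * (l^* - l)) *: (Z ^t* *m invmx S *m Z).
Proof.
have Su := pdmx_unit Spos; have [SH _] := Spos.
move=> AZ defX; pose Y := invmx S *m Z.
have defZ : Z = S *m Y by rewrite mulKVmx.
have YE : invmx S *m Z = Y by [].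
rewrite -(mulmxA _ _ Z) YE in defX *; clearbody Y.
have YS : Y ^t* *m S = Z ^t* by rewrite -{1}SH -adjmxM -defZ.
have AZH : Z ^t* *m A ^t* = l^* *: Z ^t* + E ^t* *m P ^t*.
  by rewrite -adjmxM AZ adjmxD adjmxZ adjmxM.
have XH : X ^t* = E ^t* + I *: (Y ^t* *m P *m j).
  by rewrite defX adjmxB adjmxZ -mulmxA !adjmxM trmxCK jH conjI scaleNr opprK.
have jX : j *m X = j *m E - I *: (P ^t* *m Y).
  by rewrite defX mulmxBr -scalemxAr !mulmxA jj mul1mx.
have PjP : Y ^t* *m P *m j *m P ^t* *m Y = - I *: (Y ^t* *m (l *: Z + P *m E)
    - (l^* *: Z ^t* + E ^t* *m P ^t*) *m Y).
  have -> : Y ^t* *m P *m j *m P ^t* *m Y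
      = (- I) *: (Y ^t* *m (I *: (P *m j *m P ^t*)) *m Y).
    by rewrite -scalemxAr -scalemxAl scalerA mulNr II opprK scale1r !mulmxA.
  rewrite -ident mulmxBr mulmxBl -!mulmxA -defZ AZ (mulmxA _ S) YS.
  by rewrite mulmxA AZH.
rewrite -(mulmxA _ _ X) -(mulmxA _ _ Z) YE jX XH.
have ZY : Y ^t* *m Z = Z ^t* *m Y by rewrite {1}defZ mulmxA YS.
rewrite mulmxBr !mulmxDl -!scalemxAr -!scalemxAl !mulmxA PjP.
rewrite mulmxDr mulmxDl -!scalemxAr -!scalemxAl ZY -(mulmxA _ j j) jj.
by mxlin II.
Qed.

End FormIdentity.

Section Recursion.
Variables (C : numClosedFieldType) (I : C) (n m : nat).
Variables (A S S' : 'M[C]_n) (P P' : 'M[C]_(n, m)) (j D : 'M[C]_m).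
Hypotheses (II : I * I = -1) (conjI : I^* = - I).
Hypotheses (Aunit : A \in unitmx) (Spos : pdmx S).
Hypotheses (jj : j *m j = 1%:M) (jH : j ^t* = j).
Hypothesis ident : A *m S - S *m A ^t* = I *: (P *m j *m P ^t*).
Hypothesis defP' : P' = P + I *: (invmx A *m P *m j).
Hypothesis defS' : S' = S + invmx A *m S *m invmx (A ^t*)
  + invmx A *m P *m P ^t* *m invmx (A ^t*).
Hypothesis defD : D = 1%:M + P ^t* *m invmx S *m P - P' ^t* *m invmx S' *m P'.

Let A'unit : A ^t* \in unitmx. Proof. by rewrite adjmx_unit. Qed.

Lemma next_ident : A *m S' - S' *m A ^t* = I *: (P' *m j *m P' ^t*).
Proof.
have P'H : P' ^t* = P ^t* - I *: (j *m P ^t* *m invmx (A ^t*)).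
  by rewrite defP' adjmxD adjmxZ !adjmxM jH adjmx_inv conjI scaleNr mulmxA.
have PjP : I *: (invmx A *m P *m j *m P ^t* *m invmx (A ^t*))
    = S *m invmx (A ^t*) - invmx A *m S.
  have -> : I *: (invmx A *m P *m j *m P ^t* *m invmx (A ^t*)) =
      invmx A *m (I *: (P *m j *m P ^t*)) *m invmx (A ^t*).
    by rewrite -scalemxAr -scalemxAl !mulmxA.
  by rewrite -ident mulmxBr mulmxBl mulmxA mulVmx // mul1mx mulmxA mulmxK.
have jPj : j *m P' ^t* = j *m P ^t* - I *: (P ^t* *m invmx (A ^t*)).
  by rewrite P'H mulmxBr -scalemxAr !mulmxA jj mul1mx.
rewrite -mulmxA jPj defP' mulmxDl !mulmxBr scalerDr !scalerBr.
rewrite -!scalemxAr -!scalemxAl !mulmxA -ident -(mulmxA _ j j) jj mulmx1.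
rewrite !(scalerA I I) II !scaleN1r PjP.
rewrite defS' !mulmxDl !mulmxDr !mulmxA mulmxV // !mul1mx !mulmxKV //.
by mxlin II.
Qed.

Lemma next_pos : pdmx S'.
Proof.
rewrite defS' -!adjmx_inv -addrA; apply: pdmxD => //.
apply: pdmx_psd; have -> : invmx A *m P *m P ^t* *m (invmx A) ^t*
  = invmx A *m (P *m P ^t*) *m (invmx A) ^t* by rewrite !mulmxA.
rewrite -mulmxDl -mulmxDr; apply: pdmx_congr; first by rewrite unitmx_inv.
by apply: pdmxD => //; apply: psdmx_gram.
Qed.

(** Here [D = F - P'^* S'^{-1} P'] with the [F] below. Passing to the other Schur complement leaves
    [S' - P' F^{-1} P'^*], which turns out to be [A^{-1} (S + S A^* T^{-1} A S) A^{-*}] with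
    [T = S + P P^*], and this is visibly positive. *)
Lemma step_pos : pdmx D.
Proof.
have S'p := next_pos; have Su := pdmx_unit Spos; have [SH _] := Spos.
pose T := S + P *m P ^t*.
have Tp : pdmx T by apply: pdmxD => //; apply: psdmx_gram.
have Tu := pdmx_unit Tp; have [TH _] := Tp.
pose F := 1%:M + P ^t* *m invmx S *m P.
have Fp : pdmx F.
  apply: pdmxD; first exact: pdmx1.
  by have := psdmx_congr P (pdmx_psd (pdmx_inv Spos)).
(* Woodbury identity. *)
have FI : invmx F = 1%:M - P ^t* *m invmx T *m P.
  apply: invmx_left; rewrite mulmxBr mulmx1 mulmxDl mul1mx.
  have -> : P ^t* *m invmx S *m P *m (P ^t* *m invmx T *m P)
     = P ^t* *m invmx S *m P - P ^t* *m invmx T *m P.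
    have -> : P ^t* *m invmx S *m P *m (P ^t* *m invmx T *m P)
       = P ^t* *m invmx S *m (T - S) *m invmx T *m P.
      by rewrite /T [S + _]addrC addrK !mulmxA.
    rewrite mulmxBr mulmxBl mulmxBl mulmxK // -(mulmxA _ (invmx S) S).
    by rewrite mulVmx // mulmx1.
  by rewrite [P ^t* *m invmx T *m P + _]addrC subrK addrK.
rewrite defD -/F; apply: pdmx_schur => //.
(* [P' P^* = T - G], because the identity gives [i A^{-1} P j P^* = S - G]. Hence
   [P' P^* T^{-1} P P'^*] is [T - G - G^* + G T^{-1} G^*], and its first three terms cancel against
   those of [P' P'^*]. *)
pose G := invmx A *m S *m A ^t*.
have GH : G ^t* = A *m S *m invmx (A ^t*).
  by rewrite !adjmxM SH trmxCK adjmx_inv mulmxA.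
have P'P : P' *m P ^t* = T - G.
  rewrite defP' mulmxDl -scalemxAl -!mulmxA scalemxAr (mulmxA P) -ident.
  by rewrite mulmxBr mulKmx // /T /G !mulmxA addrA [P *m _ + _]addrC.
have PP' : P *m P' ^t* = T - G ^t* by rewrite -[P]trmxCK -adjmxM P'P adjmxB TH.
have PP : P *m P ^t* = T - S by rewrite /T addrC addrA addNr add0r.
have S'E : S' = S + invmx A *m T *m invmx (A ^t*).
  by rewrite defS' /T mulmxDr mulmxDl !mulmxA addrA.
have P'jP : I *: (P' *m j *m P ^t*) = A *m S - S *m A ^t* - invmx A *m (T - S).
  rewrite ident -PP defP' !mulmxDl -!scalemxAl scalerDr scalerA II scaleN1r.
  by rewrite -(mulmxA _ j j) jj mulmx1 !mulmxA.
have P'P' : P' *m P' ^t* = T - G - G ^t* + S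
    + invmx A *m T *m invmx (A ^t*) - invmx A *m S *m invmx (A ^t*).
  have -> : P' ^t* = P ^t* - I *: (j *m P ^t* *m invmx (A ^t*)).
    by rewrite defP' adjmxD adjmxZ !adjmxM jH adjmx_inv conjI scaleNr mulmxA.
  have E : P' *m (I *: (j *m P ^t* *m invmx (A ^t*)))
      = (A *m S - S *m A ^t* - invmx A *m (T - S)) *m invmx (A ^t*).
    by rewrite -P'jP -scalemxAr -scalemxAl !mulmxA.
  rewrite mulmxBr P'P E GH !mulmxBl mulmxBr mulmxBl mulmxK //.
  by mxlin II.
have -> : S' - P' *m invmx F *m P' ^t* =
    invmx A *m (S + (A *m S) ^t* *m invmx T *m (A *m S)) *m (invmx A) ^t*.
  rewrite FI mulmxBr mulmx1 mulmxBl P'P'.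
  have -> : P' *m (P ^t* *m invmx T *m P) *m P' ^t*
      = (T - G) *m invmx T *m (T - G ^t*) by rewrite -P'P -PP' !mulmxA.
  rewrite mulmxBl mulmxV // mulmxBl mul1mx mulmxBr mulmxKV // S'E.
  have -> : invmx A *m (S + (A *m S) ^t* *m invmx T *m (A *m S)) *m (invmx A) ^t*
      = invmx A *m S *m invmx (A ^t*) + G *m invmx T *m G ^t*.
    by rewrite mulmxDr mulmxDl GH adjmxM SH adjmx_inv !mulmxA.
  by clearbody T; mxlin II.
apply: pdmx_congr; first by rewrite unitmx_inv.
by apply: pdmxD => //; apply/psdmx_congr/pdmx_psd/pdmx_inv.
Qed.

(* The intertwining relation at l = 0 with E = 1 reads D w = j w' j for
   j-unitary w and w', whence D^* j D = j. *)
Lemma step_junitary : D *m j *m D = j.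
Proof.
have Su := pdmx_unit Spos; have S'p := next_pos; have S'u := pdmx_unit S'p.
have ident' := next_ident; have [DH _] := step_pos.
pose Z := invmx A *m P; pose Z' := Z + I *: (invmx A *m Z *m j).
pose w := 1%:M - I *: (j *m P ^t* *m invmx S *m Z).
pose w' := 1%:M - I *: (j *m P' ^t* *m invmx S' *m Z').
have AZ : A *m Z = 0 *: Z + P *m 1%:M.
  by rewrite scale0r add0r mulmx1 mulKVmx.
have jC : j *m 1%:M = 1%:M *m j by rewrite mulmx1 mul1mx.
have [AZ' wD] := intertwining II conjI Aunit Su S'u jj jH ident defP' defS' defD
  jC jj AZ (erefl Z') (erefl w) (erefl w').
have I0 : I != 0.
  by apply/eqP => I0; move/eqP: II; rewrite I0 mul0r eq_sym oppr_eq0 oner_eq0.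
have Dw : D *m w = j *m w' *m j.
  move: wD; rewrite !scale0r !sub0r => /oppr_inj /(scalerI I0) H.
  by rewrite -mulmxA -H !mulmxA jj mul1mx.
have wU : w ^t* *m j *m w = j.
  rewrite (form_identity II conjI Spos jj jH ident AZ (erefl w)).
  by rewrite conjC0 subr0 mulr0 scale0r addr0 mulmx1 adjmx1 mul1mx.
have wU' : w' ^t* *m j *m w' = j.
  rewrite (form_identity II conjI S'p jj jH ident' AZ' (erefl w')).
  by rewrite conjC0 subr0 mulr0 scale0r addr0 mulmx1 adjmx1 mul1mx.
have wu : w \in unitmx.
  have : (j *m w ^t* *m j) *m w = 1%:M by rewrite -!mulmxA (mulmxA _ j w) wU jj.
  by case/mulmx1_unit.
have wHu : w ^t* \in unitmx by rewrite adjmx_unit.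
have : w ^t* *m (D *m j *m D) *m w = w ^t* *m j *m w.
  have -> : w ^t* *m (D *m j *m D) *m w = (D *m w) ^t* *m j *m (D *m w).
    by rewrite adjmxM DH !mulmxA.
  rewrite Dw !adjmxM jH wU !mulmxA -(mulmxA _ j j) jj mulmx1.
  by rewrite -(mulmxA _ (w' ^t*)) -(mulmxA _ _ w') wU' jj mul1mx.
by move/(can_inj (mulmxK wu))/(can_inj (mulKmx wHu)).
Qed.

End Recursion.

(** * Weyl solutions and resolvents *)

Section DiracSystem.
Variables (C : numClosedFieldType) (I : C) (m : nat) (j D : 'M[C]_m).
Hypotheses (II : I * I = -1) (conjI : I^* = - I).
Hypotheses (jj : j *m j = 1%:M) (jH : j ^t* = j).

(** The cross terms contribute [i (1/l^* - 1/l)] times the [D]-form, and the quadratic term, by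
    [D j D = j], another [|l|^-2] times the [j]-form. The prefactor on the left is exactly the
    inverse of [1 + |l|^-2]. *)
Lemma dirac_step (l : C) (y y' : 'cV[C]_m) :
  D ^t* = D -> D *m j *m D = j -> l != 0 ->
  y' = y - (I / l) *: (j *m D *m y) ->
  `|l| ^+ 2 / (`|l| ^+ 2 + 1) * qform j y'
    = qform j y + I * (l - l^*) / (`|l| ^+ 2 + 1) * qform D y.
Proof.
move=> DH DjD l0 ->.
have lc0 : l^* != 0 by rewrite conjC_eq0.
have n0 : l * l^* + 1 != 0.
  by rewrite -normCK lt0r_neq0 // ltr_wpDl // exprn_ge0.
have yH : (y - (I / l) *: (j *m D *m y)) ^t*
    = y ^t* + (I / l^*) *: (y ^t* *m D *m j).
  have -> : I / l^* = - (I / l)^* by rewrite rmorphM /= fmorphV conjI mulNr opprK.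
  by rewrite adjmxB adjmxZ !adjmxM DH jH !mulmxA scaleNr.
have jy : j *m (y - (I / l) *: (j *m D *m y)) = j *m y - (I / l) *: (D *m y).
  by rewrite mulmxBr -scalemxAr !mulmxA jj mul1mx.
rewrite /qform -!(mulmxA _ j) yH jy mulmxBr !mulmxDl -!scalemxAr -!scalemxAl !mulmxA.
rewrite -(mulmxA _ j j) jj mulmx1 -(mulmxA _ D j) -(mulmxA _ (D *m j) D) DjD.
rewrite !(addmxE, oppmxE, scalemxE) normCK.
move: ((y ^t* *m j *m y) 0 0) ((y ^t* *m D *m y) 0 0) => a b.
have -> : I / l * (I / l^* * a) = - (a / (l * l^*)).
  by rewrite -[- _]mulN1r -II; field; rewrite l0 lc0.
by field; apply/and3P; split.
Qed.
Lemma dirac_iter r (W : 'M[C]_m) (U X X' : 'M[C]_(m, r)) a b c :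
  W *m U = a *: X -> X - b *: (j *m D *m X) = c *: X' ->
  (W - b *: (j *m D *m W)) *m U = (a * c) *: X'.
Proof.
move=> WU XX'.
have H : j *m D *m W *m U = a *: (j *m D *m X) by rewrite -mulmxA WU scalemxAr.
by rewrite mulmxBl -scalemxAl WU H -scalerA -XX' scalerBr !scalerA [b * a]mulrC.
Qed.
End DiracSystem.

Section WeylSolution.
Variables (C : numClosedFieldType) (I : C) (n m r : nat).
Variables (A S S' : 'M[C]_n) (P P' : 'M[C]_(n, m)) (j D : 'M[C]_m).
Hypotheses (II : I * I = -1) (conjI : I^* = - I).
Hypotheses (Aunit : A \in unitmx) (Spos : pdmx S).
Hypotheses (jj : j *m j = 1%:M) (jH : j ^t* = j).
Hypothesis ident : A *m S - S *m A ^t* = I *: (P *m j *m P ^t*).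
Hypothesis defP' : P' = P + I *: (invmx A *m P *m j).
Hypothesis defS' : S' = S + invmx A *m S *m invmx (A ^t*)
  + invmx A *m P *m P ^t* *m invmx (A ^t*).
Hypothesis defD : D = 1%:M + P ^t* *m invmx S *m P - P' ^t* *m invmx S' *m P'.

Lemma weyl_step l (E : 'M[C]_(m, r)) (Z Z' : 'M[C]_(n, r)) :
  l != 0 -> j *m E = - E -> A *m Z = l *: Z + P *m E ->
  Z' = Z - I *: (invmx A *m Z) ->
  let X := E - I *: (j *m P ^t* *m invmx S *m Z) in
  let X' := E - I *: (j *m P' ^t* *m invmx S' *m Z') in
  A *m Z' = l *: Z' + P' *m E /\
  X - (I / l) *: (j *m D *m X) = (1 + I / l) *: X'.
Proof.
move=> l0 jE AZ defZ' X X'.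
have Su := pdmx_unit Spos.
have S'u := pdmx_unit (next_pos Aunit Spos defS').
have jE' : j *m E = E *m (- 1%:M) by rewrite mulmxN mulmx1.
have NN : (- 1%:M) *m (- 1%:M) = 1%:M :> 'M[C]_r by rewrite mulNmx mulmxN opprK mulmx1.
have defZ2 : Z' = Z + I *: (invmx A *m Z *m - 1%:M) by rewrite mulmxN mulmx1 scalerN.
have [-> H] := intertwining II conjI Aunit Su S'u jj jH ident defP' defS' defD
  jE' NN AZ defZ2 (erefl X) (erefl X').
split=> //; apply: (scalerI l0).
have -> : l *: (X - (I / l) *: (j *m D *m X)) = l *: X - I *: (j *m D *m X).
  by rewrite scalerBr scalerA mulrC divfK.
rewrite H mulmxN mulmx1 scalerN opprK -scalerDl scalerA.
by congr (_ *: _); rewrite mulrDr mulr1 mulrC divfK.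
Qed.
End WeylSolution.

(** * Resolvent bounds for matrices with nonnegative imaginary part *)

Section Dissipative.
Variables (C : numClosedFieldType) (I : C) (n : nat) (T G : 'M[C]_n).
Hypotheses (II : I * I = -1) (conjI : I^* = - I).
Hypotheses (Gpos : psdmx G) (ImT : T - T ^t* = I *: G).

(** With [y = (T - l) x], the quantity [t] below equals [x^* G x + s |x|^2]. Expanding
    [|(s/2) x + i y|^2 >= 0] then replaces Cauchy-Schwarz and avoids square roots; [s / 2] is the
    distance of [l] to the real axis. *)
Lemma dissipative_bound l (x : 'cV[C]_n) :
  0 <= I * (l - l^*) ->
  (I * (l - l^*) / 2) ^+ 2 * qform 1%:M x <= qform 1%:M ((T - l%:M) *m x).
Proof.
set s := I * _ => s0.
have sR : (s / 2)^* = s / 2.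
  by apply/CrealP; rewrite realE divr_ge0.
pose y := (T - l%:M) *m x; rewrite -/y.
have yE : y = T *m x - l *: x by rewrite /y mulmxBl mul_scalar_mx.
clearbody y.
have yH : y ^t* = x ^t* *m T ^t* - l^* *: x ^t*.
  by rewrite yE adjmxB adjmxM adjmxZ.
pose t := (- I) * ((x ^t* *m y) 0 0 - (y ^t* *m x) 0 0).
have tE : t = qform G x + s * qform 1%:M x.
  rewrite /t -oppmxE -addmxE -scalemxE.
  have -> : - I *: (x ^t* *m y - y ^t* *m x)
     = - I *: (x ^t* *m (T - T ^t*) *m x) + s *: (x ^t* *m x).
    rewrite yH yE /s mulmxBr mulmxBl -!scalemxAr -!scalemxAl.
    rewrite mulmxBr mulmxBl !mulmxA.
    by mxlin II.
  rewrite ImT -scalemxAr -scalemxAl scalerA mulNr II opprK scale1r.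
  by rewrite addmxE scalemxE /qform mulmx1.
have H : 0 <= (s / 2) ^+ 2 * qform 1%:M x + qform 1%:M y - s / 2 * t.
  have := qform1_ge0 ((s / 2) *: x + I *: y).
  congr (0 <= _).
  rewrite /qform !mulmx1 adjmxD !adjmxZ conjI sR.
  rewrite mulmxDl !mulmxDr -!scalemxAl -!scalemxAr !(addmxE, scalemxE) /t.
  by ring: II.
rewrite -subr_ge0; apply: le_trans H _; rewrite tE -subr_ge0.
have -> : qform 1%:M y - (s / 2) ^+ 2 * qform 1%:M x -
  ((s / 2) ^+ 2 * qform 1%:M x + qform 1%:M y -
   s / 2 * (qform G x + s * qform 1%:M x)) = s / 2 * qform G x by field.
by rewrite mulr_ge0 ?Gpos.2 // divr_ge0.
Qed.

Lemma dissipative_unit l : 0 < I * (l - l^*) -> T - l%:M \in unitmx.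
Proof.
move=> s0; rewrite -unitmx_tr unitmxE unitfE; apply/negP => /det0P[v v0 vT].
have Tv : (T - l%:M) *m v^T = 0.
  by apply: (can_inj trmxK); rewrite trmx_mul trmxK vT trmx0.
have := dissipative_bound (v^T) (ltW s0).
rewrite Tv qform0 pmulr_rle0; last by rewrite exprn_gt0 // divr_gt0.
move=> h; have : qform 1%:M v^T == 0 by rewrite eq_le h qform1_ge0.
by rewrite qform1_eq0 => /eqP/(congr1 trmx); rewrite trmxK trmx0 => /eqP; rewrite (negPf v0).
Qed.

Lemma resolvent_bound l (x : 'cV[C]_n) : 0 < I * (l - l^*) ->
  qform 1%:M (invmx (T - l%:M) *m x) <= qform 1%:M x / (I * (l - l^*) / 2) ^+ 2.
Proof.
move=> s0; rewrite ler_pdivlMr ?exprn_gt0 ?divr_gt0 // mulrC.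
by have := dissipative_bound (invmx (T - l%:M) *m x) (ltW s0); rewrite mulKVmx ?dissipative_unit.
Qed.
End Dissipative.

(** The first resolvent identity, used twice, makes the error of the difference quotient exactly [h]
    times a product of resolvents, so a bound on the resolvents near [z] suffices for
    differentiability. *)
Lemma resolvent_diff (F : fieldType) n (M : 'M[F]_n) (z h : F) :
  M - z%:M \in unitmx -> M - (z + h)%:M \in unitmx -> h != 0 ->
  h^-1 *: (invmx (M - (z + h)%:M) - invmx (M - z%:M))
    - invmx (M - z%:M) *m invmx (M - z%:M)
  = h *: (invmx (M - (z + h)%:M) *m (invmx (M - z%:M) *m invmx (M - z%:M))).
Proof.
move=> u1 u2 h0.
have first z1 z2 : M - z1%:M \in unitmx -> M - z2%:M \in unitmx ->
   invmx (M - z1%:M) - invmx (M - z2%:M)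
   = (z1 - z2) *: (invmx (M - z1%:M) *m invmx (M - z2%:M)).
  move=> v1 v2.
  have -> : invmx (M - z1%:M) - invmx (M - z2%:M) =
      invmx (M - z1%:M) *m (M - z2%:M - (M - z1%:M)) *m invmx (M - z2%:M).
    by rewrite mulmxBr mulmxBl mulmxK // mulVmx // mul1mx.
  have -> : M - z2%:M - (M - z1%:M) = (z1 - z2)%:M.
    by apply/matrixP => a b; rewrite !mxE; case: (a == b); rewrite ?mulr1n ?mulr0n; ring.
  by rewrite mul_mx_scalar -scalemxAl.
rewrite first // addrAC subrr add0r scalerA mulVf // scale1r.
by rewrite -mulmxBl first // addrAC subrr add0r -scalemxAl mulmxA.
Qed.

(** * Normalization of the Gram matrix *)

Lemma pdmx_factor (C : numClosedFieldType) n (S : 'M[C]_n) :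
  pdmx S -> exists2 L : 'M[C]_n, L \in unitmx & S = L *m L ^t*.
Proof.
move=> Sp; have [SH Spos] := Sp.
have Sherm : S \is hermsymmx.
  by apply/is_hermitianmxP; rewrite expr0 scale1r SH.
have := orthomx_spectralP (hermitian_normalmx Sherm).
set U := spectralmx S; set d := spectral_diag S => SE.
have Uun : U \is unitarymx := spectral_unitarymx S.
have Uu : U \in unitmx := unitarymx_unit Uun.
rewrite invmx_unitary // in SE; clearbody U d.
(* Each eigenvalue is the form of [S] at the eigenvector [U^* e_i], nonzero since [U] is unitary. *)
have dp i : 0 < d 0 i.
  have -> : d 0 i = qform S (U ^t* *m delta_mx i 0).
    rewrite -qform_congr trmxCK SE.
    have -> : U *m (U ^t* *m diag_mx d *m U) *m U ^t* = diag_mx d.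
      by rewrite -(invmx_unitary Uun) !mulmxA mulmxV // mul1mx mulmxK.
    by rewrite /qform trmx_delta map_delta_mx -rowE -colE !mxE eqxx mulr1n.
  apply: Spos; apply/eqP => /(congr1 (mulmx U)).
  rewrite mulmxA -(invmx_unitary Uun) mulmxV // mul1mx mulmx0.
  by move/matrixP/(_ i 0); rewrite !mxE !eqxx => /eqP; rewrite oner_eq0.
pose s := map_mx sqrtC d.
have ds : diag_mx s *m (diag_mx s) ^t* = diag_mx d.
  rewrite tr_diag_mx map_diag_mx mulmx_diag; congr diag_mx.
  apply/rowP => i; rewrite !mxE.
  transitivity (sqrtC (d 0 i) * (sqrtC (d 0 i))^*) => //.
  by rewrite conj_Creal ?ger0_real ?sqrtC_ge0 ?ltW // -expr2 sqrtCK.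
exists (U ^t* *m diag_mx s); last by rewrite adjmxM trmxCK !mulmxA -(mulmxA _ _ (_ ^t*)) ds.
rewrite unitmx_mul adjmx_unit Uu /= unitmxE det_diag unitfE.
by apply/prodf_neq0 => i _; rewrite mxE sqrtC_eq0 gt_eqF.
Qed.

Section Similarity.
Variables (C : numClosedFieldType) (n m : nat).
Variables (L A : 'M[C]_n).
Hypotheses (Lu : L \in unitmx) (Au : A \in unitmx).

Lemma invmx_sim : invmx (invmx L *m A *m L) = invmx L *m invmx A *m L.
Proof. by apply: invmx_left; rewrite !mulmxA mulmxK // mulmxK // mulVmx. Qed.

Lemma sim_rect I (P : 'M[C]_(n, m)) (j : 'M[C]_m) :
  invmx L *m P + I *: (invmx (invmx L *m A *m L) *m (invmx L *m P) *m j)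
    = invmx L *m (P + I *: (invmx A *m P *m j)).
Proof. by rewrite invmx_sim mulmxDr -scalemxAr !mulmxA mulmxK. Qed.

Lemma sim_square (S : 'M[C]_n) (P : 'M[C]_(n, m)) :
  let B := invmx L *m A *m L in
  let S1 := invmx L *m S *m (invmx L) ^t* in
  let P1 := invmx L *m P in
  S1 + invmx B *m S1 *m invmx (B ^t*) + invmx B *m P1 *m P1 ^t* *m invmx (B ^t*)
  = invmx L *m (S + invmx A *m S *m invmx (A ^t*)
      + invmx A *m P *m P ^t* *m invmx (A ^t*)) *m (invmx L) ^t*.
Proof.
move=> B S1 P1; have LHu : L ^t* \in unitmx by rewrite adjmx_unit.
have B1 : invmx (B ^t*) = L ^t* *m invmx (A ^t*) *m (invmx L) ^t*.
  by rewrite -(adjmx_inv B) invmx_sim !adjmxM !adjmx_inv mulmxA.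
rewrite B1 /S1 /P1 /B invmx_sim adjmxM !mulmxDr !mulmxDl adjmx_inv.
by rewrite !mulmxA !(mulmxK Lu) !(mulmxKV LHu).
Qed.

Lemma sim_gram_factor : 1%:M = invmx L *m (L *m L ^t*) *m (invmx L) ^t*.
Proof. by rewrite mulKmx // -adjmxM mulVmx // adjmx1. Qed.

(** [S_k] enters [C_k] only through such products, so their invariance leaves [C_k], and with it
    [W_k], unchanged. *)
Lemma sim_gram (S : 'M[C]_n) (P : 'M[C]_(n, m)) : S \in unitmx ->
  (invmx L *m P) ^t* *m invmx (invmx L *m S *m (invmx L) ^t*) *m (invmx L *m P)
   = P ^t* *m invmx S *m P.
Proof.
move=> Su; have LHu : L ^t* \in unitmx by rewrite adjmx_unit.
have -> : invmx (invmx L *m S *m (invmx L) ^t*) = L ^t* *m invmx S *m L.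
  apply: invmx_left; rewrite adjmx_inv !mulmxA mulmxKV // mulmxK // mulVmx //.
by rewrite adjmxM adjmx_inv !mulmxA mulmxKV // mulmxK.
Qed.

Lemma sim_ident a (P : 'M[C]_(n, m)) (j : 'M[C]_m) :
  A *m (L *m L ^t*) - (L *m L ^t*) *m A ^t* = a *: (P *m j *m P ^t*) ->
  let B := invmx L *m A *m L in
  B - B ^t* = a *: (invmx L *m P *m j *m (invmx L *m P) ^t*).
Proof.
move=> H /=; have LHu : L ^t* \in unitmx by rewrite adjmx_unit.
have -> : a *: (invmx L *m P *m j *m (invmx L *m P) ^t*)
    = invmx L *m (a *: (P *m j *m P ^t*)) *m invmx (L ^t*).
  by rewrite adjmxM adjmx_inv -scalemxAr -scalemxAl !mulmxA.
rewrite -H mulmxBr mulmxBl !mulmxA mulmxK // mulVmx // mul1mx.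
by rewrite !adjmxM adjmx_inv !mulmxA.
Qed.
End Similarity.

(** * Convergence of series *)

Section Polarization.
Variables (C : numClosedFieldType) (I : C).
Hypotheses (II : I * I = -1) (conjI : I^* = - I).

Lemma qform_delta n (M : 'M[C]_n) (i j : 'I_n) (a : C) :
  qform M (delta_mx i 0 + a *: delta_mx j 0)
  = M i i + a * M i j + a^* * (M j i + a * M j j).
Proof.
have dE k l : (delta_mx k 0 : 'cV[C]_n) ^t* *m M *m (delta_mx l 0 : 'cV[C]_n) = (M k l)%:M.
  rewrite trmx_delta map_delta_mx -rowE -colE; apply/matrixP=> x y.
  by rewrite !mxE !ord1 eqxx mulr1n.
rewrite /qform adjmxD adjmxZ !mulmxDl !mulmxDr -!scalemxAl -!scalemxAr.
by rewrite !dE !(addmxE, scalemxE) !mxE eqxx !mulr1n; ring.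
Qed.

(** The values at [1] and [I] isolate [M i j] up to [(1 - I) / 2] times [M i i + M j j]. The two
    forms with coefficient [0] are these diagonal entries, written so that one formula covers all
    four. *)
Lemma polarization n (M : 'M[C]_n) i j :
  M i j = 1 / 2 * qform M (delta_mx i 0 + 1 *: delta_mx j 0)
    + - I / 2 * qform M (delta_mx i 0 + I *: delta_mx j 0)
    + (I - 1) / 2 * (qform M (delta_mx i 0 + 0 *: delta_mx j 0)
                   + qform M (delta_mx j 0 + 0 *: delta_mx j 0)).
Proof.
by rewrite !qform_delta conjC1 conjC0 conjI; field: II.
Qed.
End Polarization.

Section Series.
Variable R : realType.
Local Notation C := R[i].

Definition has_limit (s : nat -> C) (L : C) : Prop :=
  forall e : C, 0 < e -> exists N : nat, forall k, (N <= k)%N -> `|s k - L| < e.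

Lemma has_limitD s t K L :
  has_limit s K -> has_limit t L -> has_limit (fun k => s k + t k) (K + L).
Proof.
move=> hs ht e e0; have e2 : 0 < e / 2 by rewrite divr_gt0.
have [[M hM] [N hN]] := (hs _ e2, ht _ e2).
exists (maxn M N) => k; rewrite geq_max => /andP[Mk Nk].
rewrite opprD addrACA [e]splitr; apply: le_lt_trans (ler_normD _ _) _.
by rewrite ltrD ?hM ?hN.
Qed.

Lemma has_limitZ a s L : has_limit s L -> has_limit (fun k => a * s k) (a * L).
Proof.
move=> hs e e0; have a1 : 0 < `|a| + 1 by rewrite ltr_wpDl.
have [|N hN] := hs (e / (`|a| + 1)); first by rewrite divr_gt0.
exists N => k /hN; rewrite ltr_pdivlMr // => h.
rewrite -mulrBr normrM mulrC; apply: le_lt_trans h.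
by rewrite ler_wpM2l // lerDl.
Qed.

Lemma has_limit_ext s t L : s =1 t -> has_limit s L -> has_limit t L.
Proof. by move=> st hs e /hs[N hN]; exists N => k /hN; rewrite st. Qed.

(** In the order of [R[i]], [0 <= s k] forces a zero imaginary part, so the limit is the supremum of
    the real parts; this is where the completeness of [R] enters. *)
Lemma nondecreasing_has_limit (s : nat -> C) (B : C) :
  (forall k, 0 <= s k) -> (forall k, s k <= s k.+1) -> (forall k, s k <= B) ->
  exists L, has_limit s L.
Proof.
move=> s0 smono sB; pose u k := complex.Re (s k).
have sE k : s k = (u k)%:C%C.
  by apply/eqP; rewrite eq_complex /= eqxx ger0_Im //= eqxx.
have umono : {homo u : k l / (k <= l)%N >-> k <= l}.
  apply: homo_leq => [x|y x z|k]; [exact: lexx|exact: le_trans|].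
  by rewrite -lecR -!sE.
pose E := [set x | exists k, x = u k]%classic.
have Eub : has_ubound E.
  exists (complex.Re B) => _ [k ->].
  by have := sB k; rewrite lecE => /andP[].
have Esup : has_sup E by split=> //; exists (u 0%N), 0%N.
exists (sup E)%:C%C => e e0.
have eE : e = (complex.Re e)%:C%C.
  by apply/eqP; rewrite eq_complex /= eqxx ger0_Im ?ltW //= eqxx.
have e0' : 0 < complex.Re e by rewrite -ltcR -eE.
have [_ [N ->] hN] := sup_adherent e0' Esup.
exists N => k Nk; rewrite sE eE -rmorphB normc_def /= expr0n addr0 sqrtr_sqr ltcR.
have uk : u k <= sup E by apply: (ub_le_sup Eub); exists k.
rewrite ler0_norm ?subr_le0 // opprB ltrBlDr -ltrBlDl.
by apply: lt_le_trans hN (umono _ _ Nk).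
Qed.

Lemma mx_series_has_limit a b (u : nat -> 'M[C]_(a, b)) :
  (forall i j, exists L, has_limit (fun N => (\sum_(k < N) u k) i j) L) ->
  mx_series_converges u.
Proof.
move=> h.
have /choice[L hL] : forall ij : 'I_a * 'I_b, exists L,
  has_limit (fun N => (\sum_(k < N) u k) ij.1 ij.2) L by case=> i j; apply: h.
exists (\matrix_(i, j) L (i, j)) => e e0.
have /choice[N hN] : forall ij : 'I_a * 'I_b, exists N : nat, forall N',
  (N <= N')%N -> `|(\sum_(k < N') u k) ij.1 ij.2 - L ij| < e.
  by move=> ij; apply: hL.
exists (\max_ij N ij) => N' NN' i j; rewrite mxE.
by apply: (hN (i, j)); apply: leq_trans NN'; apply: leq_bigmax.
Qed.

Lemma qform_sum n (u : nat -> 'M[C]_n) N (x : 'cV[C]_n) :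
  qform (\sum_(k < N) u k) x = \sum_(k < N) qform (u k) x.
Proof. by rewrite /qform mulmx_sumr mulmx_suml summxE. Qed.

(* Polarization reduces the entries of the partial sums to their quadratic
   forms, which are monotone. *)
Lemma psd_series_converges n (u : nat -> 'M[C]_n) :
  (forall k x, 0 <= qform (u k) x) ->
  (forall x, exists B, forall N, \sum_(k < N) qform (u k) x <= B) ->
  mx_series_converges u.
Proof.
move=> u0 ub; apply: mx_series_has_limit => i j.
have lim x : exists L, has_limit (fun N => qform (\sum_(k < N) u k) x) L.
  have [B hB] := ub x.
  apply: (@nondecreasing_has_limit _ B) => k; rewrite !qform_sum ?sumr_ge0 //.
  by rewrite big_ord_recr /= lerDl.
have [L1 h1] := lim (delta_mx i 0 + 1 *: delta_mx j 0).
have [L2 h2] := lim (delta_mx i 0 + Ii *: delta_mx j 0).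
have [L3 h3] := lim (delta_mx i 0 + 0 *: delta_mx j 0).
have [L4 h4] := lim (delta_mx j 0 + 0 *: delta_mx j 0).
have h := has_limitD (has_limitD (has_limitZ (1 / 2) h1) (has_limitZ (- Ii / 2) h2))
  (has_limitZ ((Ii - 1) / 2) (has_limitD h3 h4)).
exists (1 / 2 * L1 + - Ii / 2 * L2 + (Ii - 1) / 2 * (L3 + L4)); apply: has_limit_ext h => N.
by rewrite -(polarization (IiIi R) (conj_Ii R)).
Qed.

Lemma mx_series_terms_small a b (u : nat -> 'M[C]_(a, b)) i j (e : C) :
  mx_series_converges u -> 0 < e -> exists N, forall k, (N <= k)%N -> `|u k i j| < e.
Proof.
case=> L hL e0; have [|N hN] := hL (e / 2); first by rewrite divr_gt0.
exists N => k Nk; have h1 := hN k Nk i j; have h2 := hN k.+1 (leqW Nk) i j.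
move: h2; rewrite big_ord_recr /= addmxE => h2.
have -> : u k i j = ((\sum_(i0 < k) u i0) i j + u k i j - L i j)
    - ((\sum_(i0 < k) u i0) i j - L i j) by ring.
by rewrite [e]splitr; apply: le_lt_trans (ler_normB _ _) _; rewrite ltrD.
Qed.
End Series.

(** * The system in the lower half-plane *)

Section LowerHalfPlane.
Variable R : realType.
Local Notation C := R[i].

(** The quantity on the right is [-2 Im l]. It expresses the half-plane in terms available in an
    abstract closed field, where the estimates are proved. *)
Lemma lower_half_gt0 (l : C) : lower_half l <-> 0 < Ii * (l - l^*).
Proof.
rewrite /lower_half; case: l => x y; rewrite ltcE /=.
have -> : 0 * (x - x) - 1 * (y - - y) = - y *+ 2 by ring.
have -> : 0 * (y - - y) + 1 * (x - x) = 0 :> R by ring.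
by rewrite eqxx /= pmulrn_lgt0 // oppr_gt0.
Qed.

Lemma lower_half_neq0 (l : C) : lower_half l -> l != 0.
Proof. by rewrite /lower_half; apply: contraPneq => ->; rewrite ltxx. Qed.

End LowerHalfPlane.

Section Jmat.
Variable R : realType.
Variable p : nat.

Lemma jmat_sqr : jmat R p *m jmat R p = 1%:M.
Proof.
rewrite /jmat mulmx_block !mulmx0 !mul0mx !addr0 !add0r mulNmx mulmxN opprK !mulmx1.
by rewrite -scalar_mx_block.
Qed.

Lemma jmat_adj : (jmat R p) ^t* = jmat R p.
Proof. by rewrite /jmat adjmx_block !adjmx0 adjmxN !adjmx1. Qed.
End Jmat.

Section System.
Variables (R : realType) (n p : nat).
Local Notation C := R[i].
Variables (A S0 : 'M[C]_n) (Pi0 : 'M[C]_(n, p + p)).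
Hypotheses (Aunit : A \in unitmx) (S0pos : pdmx S0).
Hypothesis ident0 : A *m S0 - S0 *m A ^t* = Ii *: (Pi0 *m jmat R p *m Pi0 ^t*).
Local Notation j := (jmat R p).
Local Notation P := (Pik A Pi0).
Local Notation S := (Sk A S0 Pi0).
Local Notation D := (Ck A S0 Pi0).

Let II := IiIi R.
Let conjI := conj_Ii R.
Let jj := jmat_sqr R p.
Let jH := jmat_adj R p.

Lemma Sk_pos k : pdmx (S k).
Proof. by elim: k => [//|k IHk]; apply: (next_pos Aunit IHk (erefl (S k.+1))). Qed.

Lemma Sk_ident k : A *m S k - S k *m A ^t* = Ii *: (P k *m j *m (P k) ^t*).
Proof.
elim: k => [//|k IHk].
exact: (next_ident II conjI Aunit jj jH IHk (erefl (P k.+1)) (erefl (S k.+1))).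
Qed.

Lemma Ck_pos k : pdmx (D k).
Proof.
exact: (step_pos II conjI Aunit (Sk_pos k) jj jH (Sk_ident k)
  (erefl (P k.+1)) (erefl (S k.+1)) (erefl (D k))).
Qed.

Lemma Ck_junitary k : D k *m j *m D k = j.
Proof.
exact: (step_junitary II conjI Aunit (Sk_pos k) jj jH (Sk_ident k)
  (erefl (P k.+1)) (erefl (S k.+1)) (erefl (D k))).
Qed.

Lemma Ck_dom k x : qform j x <= qform (D k) x.
Proof.
have [_ H] := pdmx_dom_sign (Ck_pos k) jj jH (Ck_junitary k).
by rewrite -subr_ge0 -qformN -qformD.
Qed.

Variable l : C.
Hypothesis ll : lower_half l.
Local Notation q := (qfun l).
Local Notation W := (fun k => Wk A S0 Pi0 k l).
Local Notation term := (fun k x => q ^+ k * qform (D k) (W k *m x)).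
Let c := Ii * (l - l^*) / (`|l| ^+ 2 + 1).

Lemma norm_sqr_add1_gt0 : 0 < `|l| ^+ 2 + 1.
Proof. by rewrite ltr_wpDl ?exprn_ge0. Qed.

Lemma telescope_coef_gt0 : 0 < c.
Proof. by rewrite divr_gt0 ?norm_sqr_add1_gt0 //; apply/lower_half_gt0. Qed.

Lemma qfun_ge0 : 0 <= q.
Proof. by rewrite divr_ge0 ?exprn_ge0 // ltW ?norm_sqr_add1_gt0. Qed.

(** Sum of the one-step identities [dirac_step], used in two ways: since the terms are nonnegative,
    the right-hand side is at least [qform j x], which serves uniqueness; where the right-hand side
    is nonpositive, the partial sums are bounded, which serves convergence. *)
Lemma telescope_terms N x : qform j x + c * \sum_(k < N) term k x
   = q ^+ N * qform j (W N *m x).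
Proof.
elim: N => [|N IHN]; first by rewrite big_ord0 mulr0 addr0 expr0 !mul1r mul1mx.
rewrite big_ord_recr /= mulrDr addrA IHN exprSr -mulrA.
have WS : Wk A S0 Pi0 N.+1 l *m x
    = W N *m x - (Ii / l) *: (j *m D N *m (W N *m x)).
  by rewrite /= mulmxBl -scalemxAl !mulmxA.
rewrite (dirac_step II conjI jj jH (Ck_pos N).1 (Ck_junitary N) (lower_half_neq0 ll) WS).
by rewrite mulrDr mulrCA.
Qed.

Lemma term_ge0 k x : 0 <= term k x.
Proof. by rewrite mulr_ge0 ?exprn_ge0 ?qfun_ge0 // (pdmx_psd (Ck_pos k)).2. Qed.

Lemma term_ge k x : qform j x <= term k x.
Proof.
apply: (@le_trans _ _ (q ^+ k * qform j (W k *m x))); last first.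
  by rewrite ler_wpM2l ?exprn_ge0 ?qfun_ge0 ?Ck_dom.
rewrite -telescope_terms lerDl mulr_ge0 ?(ltW telescope_coef_gt0) //.
by apply: sumr_ge0 => i _; apply: term_ge0.
Qed.

End System.

(** * Realizations and uniqueness *)

Lemma psd_parallelogram (C : numClosedFieldType) n (M : 'M[C]_n) x y :
  psdmx M -> qform M (x - y) <= 2 * (qform M x + qform M y).
Proof.
case=> _ Mp; rewrite -subr_ge0; have := Mp (x + y); congr (0 <= _).
rewrite /qform adjmxB adjmxD !mulmxDl !mulmxDr !mulmxN !mulNmx.
by rewrite !(addmxE, oppmxE); ring.
Qed.

Lemma ler_psd_parallelogram (C : numClosedFieldType) n (M : 'M[C]_n) a x y :
  0 <= a -> psdmx M ->
  a * qform M (x - y) <= 2 * (a * qform M x + a * qform M y).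
Proof.
move=> a0 Mp; rewrite -mulrDr mulrCA ler_wpM2l //.
exact: psd_parallelogram.
Qed.

Lemma lt_quarters_absurd (F : numFieldType) (a b v : F) :
  a < v / 4 -> b < v / 4 -> v <= 2 * (a + b) -> false.
Proof.
move=> av bv h; have : 2 * (a + b) < 2 * (v / 4 + v / 4) by rewrite ltr_pM2l // ltrD.
move/(le_lt_trans h); have -> : 2 * (v / 4 + v / 4) = v by field.
by rewrite ltxx.
Qed.

(** The two columns share their lower block, so their difference lives in the upper one, where the
    signature is positive. *)
Lemma qform_signature_diff (C : numClosedFieldType) p (f g : 'M[C]_p) (e : 'cV[C]_p) :
  qform (block_mx 1%:M 0 0 (- 1%:M)) (col_mx f 1%:M *m e - col_mx g 1%:M *m e)
    = qform 1%:M ((f - g) *m e).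
Proof.
have -> : col_mx f 1%:M *m e - col_mx g 1%:M *m e = col_mx ((f - g) *m e) 0.
  by rewrite -mulmxBl opp_col_mx add_col_mx mul_col_mx mulmxBl (mulmxBl 1%:M) subrr.
rewrite /qform mulmx1 adjmx_col adjmx0 mul_row_block mul_row_col.
by rewrite !mulmx0 !addr0 mulmx1.
Qed.

Section Realization.
Variables (C : numClosedFieldType) (I : C) (n p : nat).
Variables (T : 'M[C]_n) (Phi Psi : 'M[C]_(n, p)).
Hypotheses (II : I * I = -1) (conjI : I^* = - I).
Let j : 'M[C]_(p + p) := block_mx 1%:M 0 0 (- 1%:M).
Let A := T - I *: (Psi *m Psi ^t*).

(** Subtracting [i Psi Psi^*] from [T] removes it twice from [T - T^*]; this flips the sign of
    [Psi Psi^*] and produces [j]. *)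
Lemma realization_ident : T - T ^t* = I *: (Phi *m Phi ^t* + Psi *m Psi ^t*) ->
  A *m 1%:M - 1%:M *m A ^t* = I *: (row_mx Phi Psi *m j *m (row_mx Phi Psi) ^t*).
Proof.
move=> ImT; rewrite mulmx1 mul1mx adjmx_row mul_row_block mul_row_col.
rewrite !mulmx0 addr0 add0r mulmxN !mulmx1 mulNmx.
rewrite /A adjmxB adjmxZ adjmxM trmxCK conjI.
have -> : T - I *: (Psi *m Psi ^t*) - (T ^t* - - I *: (Psi *m Psi ^t*))
  = (T - T ^t*) - (I *: (Psi *m Psi ^t*) + I *: (Psi *m Psi ^t*)) by mxlin II.
by rewrite ImT; mxlin II.
Qed.

Lemma realization_ident_inv (B : 'M[C]_n) :
  B - B ^t* = I *: (row_mx Phi Psi *m j *m (row_mx Phi Psi) ^t*) ->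
  let K := B + I *: (Psi *m Psi ^t*) in
  K - K ^t* = I *: (Phi *m Phi ^t* + Psi *m Psi ^t*).
Proof.
rewrite adjmx_row mul_row_block mul_row_col.
rewrite !mulmx0 addr0 add0r mulmxN !mulmx1 mulNmx => BB /=.
rewrite adjmxD adjmxZ adjmxM trmxCK conjI opprD addrACA BB.
by mxlin II.
Qed.

Variables (l : C) (V : 'M[C]_p) (Z : 'M[C]_(n, p)).
Hypothesis Tl : T - l%:M \in unitmx.
Hypotheses (defZ : Z = invmx (T - l%:M) *m Psi) (defV : V = 1%:M - I *: (Psi ^t* *m Z)).

Lemma realization_state :
  A *m Z = l *: Z + row_mx Phi Psi *m col_mx 0 V.
Proof.
have TZ : T *m Z = l *: Z + Psi.
  by apply/eqP; rewrite addrC -subr_eq -mul_scalar_mx -mulmxBl defZ mulKVmx.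
rewrite mul_row_col mulmx0 add0r defV mulmxBr mulmx1 /A mulmxBl TZ.
by mxlin II.
Qed.

Lemma realization_initial :
  col_mx 0 V - I *: (j *m (row_mx Phi Psi) ^t* *m invmx 1%:M *m Z)
    = col_mx (- I *: (Phi ^t* *m invmx (T - l%:M) *m Psi)) 1%:M.
Proof.
rewrite invmx1 mulmx1 adjmx_row mul_block_col !mul0mx addr0 add0r mul1mx mulNmx mul1mx.
rewrite mul_col_mx scale_col_mx opp_col_mx add_col_mx add0r -mulmxA -defZ scaleNr.
by congr col_mx; rewrite defV mulNmx scalerN opprK subrK.
Qed.

Lemma signature_bottom : j *m col_mx 0 V = - col_mx 0 V.
Proof.
by rewrite mul_block_col !mulmx0 !mul0mx !add0r mulNmx mul1mx opp_col_mx oppr0.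
Qed.

Lemma weyl_form_le0 (B S : 'M[C]_n) (P : 'M[C]_(n, p + p)) (Y : 'M[C]_(n, p)) (e : 'cV[C]_p) :
  pdmx S -> B *m S - S *m B ^t* = I *: (P *m j *m P ^t*) ->
  0 < I * (l - l^*) -> B *m Y = l *: Y + P *m col_mx 0 V ->
  qform j ((col_mx 0 V - I *: (j *m P ^t* *m invmx S *m Y)) *m e) <= 0.
Proof.
move=> Sp identB s0 BY.
have jj : j *m j = 1%:M.
  rewrite mulmx_block !mulmx0 !mul0mx !addr0 !add0r mulNmx mulmxN opprK !mulmx1.
  by rewrite -scalar_mx_block.
have jH : j ^t* = j by rewrite adjmx_block !adjmx0 adjmxN !adjmx1.
have EjE : qform ((col_mx 0 V) ^t* *m j *m col_mx 0 V) e
    = - qform 1%:M ((col_mx 0 V : 'M_(p + p, p)) *m e).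
  by rewrite -mulmxA signature_bottom mulmxN qformN -(qform_congr (col_mx 0 V)) mulmx1.
move: BY EjE; set E := col_mx 0 V => BY EjE.
rewrite -qform_congr (form_identity II conjI Sp jj jH identB BY (erefl _)).
rewrite qformD EjE qformZ qform_congr -[l^* - l]opprB mulrN mulNr -opprD oppr_le0.
by rewrite addr_ge0 ?qform1_ge0 // mulr_ge0 ?(ltW s0) // (pdmx_psd (pdmx_inv Sp)).2.
Qed.
End Realization.

Section Weyl.
Variables (R : realType) (n p : nat).
Local Notation C := R[i].
Local Notation j := (jmat R p).
Variables (A S0 : 'M[C]_n) (Pi0 : 'M[C]_(n, p + p)).
Hypotheses (Aunit : A \in unitmx) (S0pos : pdmx S0).
Hypothesis ident0 : A *m S0 - S0 *m A ^t* = Ii *: (Pi0 *m j *m Pi0 ^t*).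
Variable l : C.
Hypothesis ll : lower_half l.

Definition weyl_series (f : 'M[C]_p) k : 'M[C]_p :=
  (col_mx f 1%:M) ^t* *m (qfun l ^+ k *:
    ((Wk A S0 Pi0 k l) ^t* *m Ck A S0 Pi0 k *m Wk A S0 Pi0 k l)) *m col_mx f 1%:M.

Lemma qform_weyl_series f k x : qform (weyl_series f k) x
  = qfun l ^+ k * qform (Ck A S0 Pi0 k) (Wk A S0 Pi0 k l *m (col_mx f 1%:M *m x)).
Proof. by rewrite qform_congr qformZ qform_congr. Qed.

(** If [f] and [g] differ on a basis vector [e], every term evaluated on the difference of the two
    columns is at least [|(f - g) e|^2], yet it is at most twice the sum of two terms of convergent
    series. *)
Lemma weyl_unique f g : mx_series_converges (weyl_series f) ->
  mx_series_converges (weyl_series g) -> f = g.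
Proof.
move=> hf hg; apply/eqP; rewrite -subr_eq0; apply/eqP/matrixP => i0 i; move: i0.
suff : (f - g) *m (delta_mx i 0 : 'cV_p) = 0.
  by rewrite -colE => /colP h i0; have := h i0; rewrite !mxE.
set e : 'cV_p := delta_mx i 0; set v := _ *m e.
apply/eqP; rewrite -qform1_eq0; apply: contraT => v0.
have vpos : 0 < qform 1%:M v by rewrite lt_def v0 qform1_ge0.
have jv : qform j (col_mx f 1%:M *m e - col_mx g 1%:M *m e) = qform 1%:M v.
  exact: qform_signature_diff.
(* The quarter absorbs the factor 2 of the parallelogram bound and its two summands. *)
have v4 : 0 < qform 1%:M v / 4 by rewrite divr_gt0.
have [M hM] := mx_series_terms_small i i hf v4.
have [N hN] := mx_series_terms_small i i hg v4.
pose k := maxn M N.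
have diag h : weyl_series h k i i = qform (weyl_series h k) e.
  by rewrite /qform trmx_delta map_delta_mx -rowE -colE !mxE.
have ge0 h : 0 <= qform (weyl_series h k) e.
  by rewrite qform_weyl_series; apply: term_ge0.
have fk : qform (weyl_series f k) e < qform 1%:M v / 4.
  by rewrite -(ger0_norm (ge0 f)) -diag; apply/hM/leq_maxl.
have gk : qform (weyl_series g k) e < qform 1%:M v / 4.
  by rewrite -(ger0_norm (ge0 g)) -diag; apply/hN/leq_maxr.
apply: (lt_quarters_absurd fk gk).
have := term_ge Aunit S0pos ident0 ll k (col_mx f 1%:M *m e - col_mx g 1%:M *m e).
rewrite jv mulmxBr => /le_trans; apply; rewrite !qform_weyl_series.
apply: ler_psd_parallelogram; first by rewrite exprn_ge0 ?qfun_ge0.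
exact/pdmx_psd/Ck_pos.
Qed.

End Weyl.

(** * Holomorphy *)

Section EntryBounds.
Variable C : numClosedFieldType.

(** From [t <= 1 + t^2]: crude, but free of square roots, and enough wherever only a bound uniform
    in [h] matters. *)
Lemma entry_le_qform1 n (x : 'cV[C]_n) i : `|x i 0| <= 1 + qform 1%:M x.
Proof.
apply: (@le_trans _ _ (1 + `|x i 0| ^+ 2)).
  rewrite -subr_ge0.
  have -> : 1 + `|x i 0| ^+ 2 - `|x i 0| = (`|x i 0| - 1) ^+ 2 + `|x i 0| by ring.
  by rewrite addr_ge0 // real_exprn_even_ge0 // rpredB ?rpred1 // normr_real.
rewrite lerD2l qform1E (bigD1 i) //= lerDl sumr_ge0 // => k _.
by rewrite exprn_ge0.
Qed.

Lemma mulmx_entry_le m n p (A : 'M[C]_(m, n)) (B : 'M[C]_(n, p)) i k b :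
  (forall l, `|B l k| <= b) -> `|(A *m B) i k| <= (\sum_l `|A i l|) * b.
Proof.
move=> Bb; rewrite mxE; apply: le_trans (ler_norm_sum _ _ _) _.
by rewrite mulr_suml ler_sum // => l _; rewrite normrM ler_wpM2l.
Qed.
End EntryBounds.

Section Holomorphy.
Variables (C : numClosedFieldType) (I : C) (n p : nat).
Variables (T G : 'M[C]_n) (Phi Psi : 'M[C]_(n, p)).
Hypotheses (II : I * I = -1) (conjI : I^* = - I).
Hypotheses (Gpos : psdmx G) (ImT : T - T ^t* = I *: G).
Let f (l : C) := - I *: (Phi ^t* *m invmx (T - l%:M) *m Psi).
Let s (l : C) := I * (l - l^*).

Lemma norm_I : `|I| = 1.
Proof.
apply/eqP; rewrite -(@eqrXn2 _ 2) ?ler01 // expr1n normCK conjI mulrN II.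
by rewrite opprK.
Qed.

Lemma half_plane_shift z h : s z - 2 * `|h| <= s (z + h).
Proof.
have real_I w : s w \is Num.real.
  apply/CrealP; rewrite /s rmorphM /= conjI rmorphB /= conjCK; ring.
have -> : s (z + h) = s z + s h by rewrite /s rmorphD /=; ring.
rewrite lerD2l -lerNl; apply: le_trans (real_ler_norm _) _; first by rewrite rpredN.
rewrite normrN normrM norm_I mul1r (le_trans (ler_normB _ _)) // norm_conjC.
by rewrite mulr_natl mulr2n.
Qed.

(** The derivative is given by the squared resolvent. The conclusion keeps [0 < s (z + h)] because a
    Weyl function is known to agree with [f] only in the half-plane. *)
Lemma transfer_derivative z : 0 < s z ->
  exists D : 'M[C]_p, forall e : C, 0 < e ->
    exists d : C, 0 < d /\ forall h : C, h != 0 -> `|h| < d ->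
      0 < s (z + h) /\
      forall i j, `| (f (z + h) i j - f z i j) / h - D i j | < e.
Proof.
move=> sz; pose Q := invmx (T - z%:M) *m invmx (T - z%:M) *m Psi.
exists (- I *: (Phi ^t* *m Q)) => e e0.
(* For [|h| < s z / 4] one has [s (z + h) >= s z / 2], so the resolvent bound at [z + h] holds with
   [s z / 4] as the distance, uniformly in such [h]. *)
pose b k := 1 + qform 1%:M (col k Q) / (s z / 4) ^+ 2.
pose K := 1 + \sum_i \sum_k (\sum_l `|Phi ^t* i l|) * b k.
have b0 k : 0 <= b k.
  by rewrite addr_ge0 // divr_ge0 ?qform1_ge0 // exprn_ge0 // divr_ge0 // ltW.
have t0 i k : 0 <= (\sum_l `|Phi ^t* i l|) * b k by rewrite mulr_ge0 // sumr_ge0.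
have K0 : 0 < K.
  by rewrite ltr_pwDl // sumr_ge0 // => i _; rewrite sumr_ge0.
have K1 i k : (\sum_l `|Phi ^t* i l|) * b k <= K.
  rewrite /K (bigD1 i) //= (bigD1 k) //= addrCA -!addrA lerDl !addr_ge0 //.
    by rewrite sumr_ge0.
  by rewrite sumr_ge0 // => ? _; rewrite sumr_ge0.
(* The reciprocal of the sum lies below both [s z / 4] and [e / K], in place of a minimum. *)
pose d := (4 / s z + K / e)^-1.
have dp1 : 0 < 4 / s z by rewrite divr_gt0.
have dp2 : 0 < K / e by rewrite divr_gt0.
have d0 : 0 < d by rewrite invr_gt0 addr_gt0.
have d1 : d <= s z / 4.
  by rewrite -[s z / 4]invf_div lef_pV2 ?posrE ?addr_gt0 // lerDl ltW.
have d2 : d <= e / K.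
  by rewrite -[e / K]invf_div lef_pV2 ?posrE ?addr_gt0 // lerDr ltW.
exists d; split=> // h h0 hd.
have sh : s z / 2 <= s (z + h).
  apply: le_trans (half_plane_shift z h); rewrite -subr_ge0.
  have -> : s z - 2 * `|h| - s z / 2 = 2 * (s z / 4 - `|h|) by field.
  by rewrite mulr_ge0 // subr_ge0 (le_trans (ltW hd)).
have szh : 0 < s (z + h) by apply: lt_le_trans sh; rewrite divr_gt0.
split=> // i k.
have u1 := dissipative_unit II conjI Gpos ImT sz.
have u2 := dissipative_unit II conjI Gpos ImT szh.
have -> : (f (z + h) i k - f z i k) / h - (- I *: (Phi ^t* *m Q)) i k
    = - I * h * (Phi ^t* *m (invmx (T - (z + h)%:M) *m Q)) i k.
  have := resolvent_diff u1 u2 h0.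
  move/(congr1 (fun M => (- I *: (Phi ^t* *m M *m Psi)) i k)).
  rewrite /f /Q !mulmxBr !mulmxBl -!scalemxAr -!scalemxAl !mulmxBr !mulmxBl !mulmxA.
  rewrite !(scalemxE, addmxE, oppmxE) => H.
  by rewrite mulrC in H *; rewrite -mulrA -H; ring.
rewrite !normrM normrN norm_I mul1r.
have bound l : `|(invmx (T - (z + h)%:M) *m Q) l k| <= b k.
  have -> : (invmx (T - (z + h)%:M) *m Q) l k = (invmx (T - (z + h)%:M) *m col k Q) l 0.
    by rewrite colE mulmxA -colE [RHS]mxE.
  apply: le_trans (entry_le_qform1 _ _) _; rewrite lerD2l.
  apply: le_trans (resolvent_bound II conjI Gpos ImT _ szh) _.
  rewrite ler_wpM2l ?qform1_ge0 // lef_pV2 ?posrE ?exprn_gt0 ?divr_gt0 //.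
  rewrite lerXn2r ?nnegrE ?divr_ge0 ?(ltW sz) ?(ltW szh) //.
  by rewrite ler_pdivlMr // (le_trans _ sh) //; have -> : s z / 4 * 2 = s z / 2 by field.
have := mulmx_entry_le (Phi ^t*) i bound.
move/le_trans/(_ (K1 i k)) => leK.
apply: (@le_lt_trans _ _ (`|h| * K)); first by rewrite ler_wpM2l.
by rewrite -ltr_pdivlMr // (lt_le_trans hd).
Qed.
End Holomorphy.

(** * Weyl functions *)

Section Existence.
Variables (R : realType) (n p : nat).
Local Notation C := R[i].
Local Notation j := (jmat R p).
Variables (T : 'M[C]_n) (Phi Psi : 'M[C]_(n, p)).
Hypothesis ImT : T - T ^t* = Ii *: (Phi *m Phi ^t* + Psi *m Psi ^t*).
Let A := T - Ii *: (Psi *m Psi ^t*).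
Hypothesis Aunit : A \in unitmx.
Let Pi0 := row_mx Phi Psi.
Let f (l : C) := - Ii *: (Phi ^t* *m invmx (T - l%:M) *m Psi).

Let II := IiIi R.
Let conjI := conj_Ii R.
Let one_pos := pdmx1 C n.

Lemma gram_sum_psd : psdmx (Phi *m Phi ^t* + Psi *m Psi ^t*).
Proof. exact: psdmxD (psdmx_gram Phi) (psdmx_gram Psi). Qed.

Let ident0 : A *m 1%:M - 1%:M *m A ^t* = Ii *: (Pi0 *m j *m Pi0 ^t*).
Proof. exact: realization_ident II conjI ImT. Qed.

Lemma weyl_solution_le0 l k e : lower_half l ->
  qform j (Wk A 1%:M Pi0 k l *m (col_mx (f l) 1%:M *m e)) <= 0.
Proof.
move=> ll; have s0 := (lower_half_gt0 l).1 ll.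
have Tl := dissipative_unit II conjI gram_sum_psd ImT s0.
pose Z0 := invmx (T - l%:M) *m Psi; pose V := 1%:M - Ii *: (Psi ^t* *m Z0).
(* The state [Z] is existential in the induction: [A - l] may be singular, so no resolvent of [A]
   describes it, and the state equation is all that is passed on. *)
have [Z [AZ WE]] : exists Z, A *m Z = l *: Z + Pik A Pi0 k *m col_mx 0 V /\
  Wk A 1%:M Pi0 k l *m col_mx (f l) 1%:M = (1 + Ii / l) ^+ k *:
    (col_mx 0 V - Ii *: (j *m (Pik A Pi0 k) ^t* *m invmx (Sk A 1%:M Pi0 k) *m Z)).
  elim: k => [|k [Z [AZ IHk]]].
    exists Z0; split; first exact: realization_state.
    rewrite expr0 scale1r mul1mx; apply: esym.
    exact: realization_initial.
  exists (Z - Ii *: (invmx A *m Z)).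
  have [AZ' X'] := weyl_step II conjI Aunit (Sk_pos Pi0 Aunit one_pos k)
    (jmat_sqr R p) (jmat_adj R p) (Sk_ident Aunit ident0 k)
    (erefl (Pik A Pi0 k.+1)) (erefl (Sk A 1%:M Pi0 k.+1)) (erefl (Ck A 1%:M Pi0 k))
    (lower_half_neq0 ll) (signature_bottom V) AZ (erefl _).
  by split; [exact: AZ' | rewrite exprSr; exact: dirac_iter IHk X'].
rewrite mulmxA WE -scalemxAl.
apply: qform_scale_le0.
exact: (weyl_form_le0 II conjI e (Sk_pos Pi0 Aunit one_pos k) (Sk_ident Aunit ident0 k) s0 AZ).
Qed.

Lemma weyl_series_converges l : lower_half l ->
  mx_series_converges (weyl_series A 1%:M Pi0 l (f l)).
Proof.
move=> ll; apply: psd_series_converges => [k x|x].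
  by rewrite qform_weyl_series; apply: term_ge0.
set y := col_mx (f l) 1%:M *m x.
pose c := Ii * (l - l^*) / (`|l| ^+ 2 + 1).
(* By [telescope_terms] and the nonpositive form of the Weyl solution, [c] times any partial sum is
   at most [- qform j y]. *)
exists (- qform j y / c) => N; rewrite ler_pdivlMr ?telescope_coef_gt0 // mulrC.
under eq_bigr do rewrite qform_weyl_series.
rewrite -subr_le0 opprK addrC (telescope_terms Aunit one_pos ident0 ll).
by rewrite mulr_ge0_le0 ?exprn_ge0 ?qfun_ge0 ?weyl_solution_le0.
Qed.

Lemma transfer_holomorphic (g : C -> 'M[C]_p) :
  (forall l, lower_half l -> g l = f l) -> holomorphic_lower g.
Proof.
move=> gf z zl; have s0 := (lower_half_gt0 z).1 zl.
have [D hD] := transfer_derivative Phi Psi II conjI gram_sum_psd ImT s0.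
exists D => e e0; have [d [d0 hd]] := hD e e0; exists d; split=> // h h0 hlt i k.
have [sh lt_e] := hd h h0 hlt.
by rewrite !gf //; apply/lower_half_gt0.
Qed.
End Existence.

(** * Invariance of the system under the similarity that reduces the Gram matrix to the identity *)

Section Normalization.
Variables (R : realType) (n p : nat).
Local Notation C := R[i].
Variables (L A : 'M[C]_n) (Pi0 : 'M[C]_(n, p + p)).
Hypotheses (Lu : L \in unitmx) (Au : A \in unitmx).
Let S0 := L *m L ^t*.
Let B := invmx L *m A *m L.
Let Pi1 := invmx L *m Pi0.
Hypothesis Spos : forall k, pdmx (Sk A S0 Pi0 k).

Lemma Pik_sim k : Pik B Pi1 k = invmx L *m Pik A Pi0 k.
Proof. by elim: k => [//|k IHk] /=; rewrite IHk; apply: sim_rect. Qed.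

Lemma Sk_sim k : Sk B 1%:M Pi1 k = invmx L *m Sk A S0 Pi0 k *m (invmx L) ^t*.
Proof.
elim: k => [|k IHk] /=; first exact: sim_gram_factor.
by rewrite IHk Pik_sim; apply: sim_square.
Qed.

Lemma Ck_sim k : Ck B 1%:M Pi1 k = Ck A S0 Pi0 k.
Proof.
have E i : (Pik B Pi1 i) ^t* *m invmx (Sk B 1%:M Pi1 i) *m Pik B Pi1 i
  = (Pik A Pi0 i) ^t* *m invmx (Sk A S0 Pi0 i) *m Pik A Pi0 i.
  by rewrite Pik_sim Sk_sim; apply: sim_gram => //; apply: pdmx_unit.
exact: (congr2 (fun X Y => 1%:M + X - Y) (E k) (E k.+1)).
Qed.

Lemma Wk_sim k l : Wk B 1%:M Pi1 k l = Wk A S0 Pi0 k l.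
Proof. by elim: k => [//|k IHk] /=; rewrite Ck_sim IHk. Qed.

Lemma weyl_series_sim l f : weyl_series B 1%:M Pi1 l f =1 weyl_series A S0 Pi0 l f.
Proof. by move=> k; rewrite /weyl_series Ck_sim Wk_sim. Qed.
End Normalization.

Unset Implicit Arguments.

Theorem theorem4p5 (R : realType) (p : nat) (phi : R[i] -> 'M[R[i]]_p) :
  (1 <= p)%N ->
  ((exists (n : nat) (A S0 : 'M[R[i]]_n) (Pi0 : 'M[R[i]]_(n, p + p)),
      param_matrices A S0 Pi0 /\ posdef S0 /\ is_Weyl_function A S0 Pi0 phi)
   <->
   (exists (n : nat) (theta : 'M[R[i]]_n) (Phi Psi : 'M[R[i]]_(n, p)),
      theta - theta ^t* = Ii *: (Phi *m Phi ^t* + Psi *m Psi ^t*) /\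
      \det (theta - Ii *: (Psi *m Psi ^t*)) != 0 /\
      forall l : R[i], lower_half l ->
        phi l = - Ii *: (Phi ^t* *m invmx (theta - l%:M) *m Psi)))
  /\
  (forall (n : nat) (theta : 'M[R[i]]_n) (Phi Psi : 'M[R[i]]_(n, p)),
      theta - theta ^t* = Ii *: (Phi *m Phi ^t* + Psi *m Psi ^t*) ->
      \det (theta - Ii *: (Psi *m Psi ^t*)) != 0 ->
      (forall l : R[i], lower_half l ->
        phi l = - Ii *: (Phi ^t* *m invmx (theta - l%:M) *m Psi)) ->
      param_matrices (theta - Ii *: (Psi *m Psi ^t*)) 1%:M (row_mx Phi Psi) /\
      is_Weyl_function (theta - Ii *: (Psi *m Psi ^t*)) 1%:M (row_mx Phi Psi) phi /\
      (forall k : nat,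
        posdef (Ck (theta - Ii *: (Psi *m Psi ^t*)) 1%:M (row_mx Phi Psi) k))).
Proof.
move=> _.
(* This is the last assertion of the theorem; with [S0 = 1] it also yields sufficiency. *)
have direct n (T : 'M[R[i]]_n) (Phi Psi : 'M[R[i]]_(n, p)) :
    T - T ^t* = Ii *: (Phi *m Phi ^t* + Psi *m Psi ^t*) ->
    \det (T - Ii *: (Psi *m Psi ^t*)) != 0 ->
    (forall l : R[i], lower_half l ->
      phi l = - Ii *: (Phi ^t* *m invmx (T - l%:M) *m Psi)) ->
    param_matrices (T - Ii *: (Psi *m Psi ^t*)) 1%:M (row_mx Phi Psi) /\
    is_Weyl_function (T - Ii *: (Psi *m Psi ^t*)) 1%:M (row_mx Phi Psi) phi /\
    (forall k : nat,
      posdef (Ck (T - Ii *: (Psi *m Psi ^t*)) 1%:M (row_mx Phi Psi) k)).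
  move=> ImT Adet phiE.
  have Au : T - Ii *: (Psi *m Psi ^t*) \in unitmx by rewrite unitmxE unitfE.
  have ident0 := realization_ident (IiIi R) (conj_Ii R) ImT.
  split; first by split; [|split; [exact: adjmx1|exact: ident0]].
  split; last by move=> k; apply: Ck_pos Au (pdmx1 _ _) ident0 k.
  split; first exact: transfer_holomorphic ImT _ phiE.
  by move=> l ll; rewrite phiE //; apply: weyl_series_converges.
split=> //; split; last first.
  case=> n [T [Phi [Psi [ImT [Adet phiE]]]]].
  exists n, (T - Ii *: (Psi *m Psi ^t*)), 1%:M, (row_mx Phi Psi).
  have [par [weyl _]] := direct n T Phi Psi ImT Adet phiE.
  by split=> //; split=> //; apply: pdmx1.
case=> n [A [S0 [Pi0 [[Adet [_ ident]] [S0pos [_ weyl]]]]]].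
have Au : A \in unitmx by rewrite unitmxE unitfE.
have [L Lu defS0] := pdmx_factor S0pos.
subst S0.
pose B := invmx L *m A *m L; pose Pi1 := invmx L *m Pi0.
pose Phi := lsubmx Pi1; pose Psi := rsubmx Pi1.
have PiE : Pi1 = row_mx Phi Psi by rewrite hsubmxK.
have identB : B - B ^t* = Ii *: (row_mx Phi Psi *m jmat R p *m (row_mx Phi Psi) ^t*).
  by rewrite -PiE; apply: sim_ident.
have ImT := realization_ident_inv (IiIi R) (conj_Ii R) identB.
pose T := B + Ii *: (Psi *m Psi ^t*).
have TB : T - Ii *: (Psi *m Psi ^t*) = B by rewrite addrK.
have Bu : B \in unitmx by rewrite !unitmx_mul unitmx_inv Lu Au.
have TBu : T - Ii *: (Psi *m Psi ^t*) \in unitmx by rewrite TB.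
exists n, T, Phi, Psi; split=> //; split; first by rewrite -unitfE -unitmxE.
move=> l ll.
have conv := weyl_series_converges ImT TBu ll; rewrite TB -PiE in conv.
have ident1 : B *m 1%:M - 1%:M *m B ^t* = Ii *: (Pi1 *m jmat R p *m Pi1 ^t*).
  by rewrite mulmx1 mul1mx PiE.
(* The series of [phi] for the original system is the same as for the normalized one, so at this [l]
   both [phi] and the realization give convergence and must coincide. *)
apply: (weyl_unique Bu (pdmx1 _ _) ident1 ll) conv.
have Spos k := Sk_pos Pi0 Au S0pos k.
have -> : weyl_series B 1%:M Pi1 l (phi l) = weyl_series A (L *m L ^t*) Pi0 l (phi l).
  by apply: funext; apply: weyl_series_sim.
exact: weyl.
Qed.
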